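(* Let $T>0$ and let $u^+,u^-:[0,T]\times\mathbb{R}\to[0,\infty)$ be continuous nonnegative functions such that $\partial_x^2u^\pm\in L^1([0,T];L^\infty(\mathbb{R}))$ and $\langle x\rangle^{-2}\partial_tu^\pm\in L^1([0,T];L^\infty(\mathbb{R}))$, and such that $$\partial_tu^+\ge\tfrac12u^+\partial_x^2u^+\quad\text{and}\quad\partial_tu^-\le\tfrac12u^-\partial_x^2u^-\qquad\text{a.e. on }[0,T]\times\mathbb{R}.$$ If $u^-(0,\cdot)\le u^+(0,\cdot)$, then $u^-\le u^+$ on $[0,T]\times\mathbb{R}$.
   Context: $\langle x\rangle=(x^2+1)^{1/2}$. Derivatives are weak (distributional) derivatives. *)

(* Defs.v *)
From HB Require Import structures.
From mathcomp Require Import all_boot all_order all_algebra.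
From mathcomp Require Import all_classical all_reals all_analysis.
Import Order.TTheory GRing.Theory Num.Theory.
Import numFieldNormedType.Exports.

Set Implicit Arguments.
Unset Strict Implicit.
Unset Printing Implicit Defensive.

Local Open Scope classical_set_scope.
Local Open Scope ring_scope.

(* Points of space-time are pairs p = (t, x) : R * R, with the Borel product
   sigma-algebra.  Every Lebesgue class has a Borel representative. *)

Section SpaceTime.
Context {R : realType}.
Implicit Types (u g phi : R * R -> R) (Omega K : set (R * R)) (T : R).

Definition leb1 : {measure set (measurableTypeR R) -> \bar R} :=
  @lebesgue_measure R.

Definition leb2 :
    {measure set (measurableTypeR R * measurableTypeR R)%type -> \bar R} :=
  (@lebesgue_measure R \x @lebesgue_measure R)%E.

Definition japanese_bracket (x : R) : R := Num.sqrt (x ^+ 2 + 1).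

Definition slab T : set (R * R) := `[0, T] `*` setT.
Definition open_slab T : set (R * R) := `]0, T[ `*` setT.

Definition pdt phi : R * R -> R := fun p => derive1 (fun s => phi (s, p.2)) p.1.
Definition pdx phi : R * R -> R := fun p => derive1 (fun y => phi (p.1, y)) p.2.

Fixpoint Ck (k : nat) phi : Prop :=
  if k is k'.+1 then
    [/\ forall p : R * R, derivable (fun s => phi (s, p.2)) p.1 1,
        forall p : R * R, derivable (fun y => phi (p.1, y)) p.2 1,
        continuous phi, Ck k' (pdt phi) & Ck k' (pdx phi)]
  else continuous phi.

Definition test_function Omega phi : Prop :=
  [/\ forall k, Ck k phi,
      compact (closure [set p | phi p != 0]) &
      closure [set p | phi p != 0] `<=` Omega].

Definition loc_integrable Omega u : Prop :=
  measurable_fun (Omega : set (measurableTypeR R * measurableTypeR R)) u /\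
  forall K, compact K -> K `<=` Omega -> leb2.-integrable K (EFin \o u).

(* g represents the distributional derivative d_t^i d_x^j u on Omega. *)
Definition weak_derivative Omega (i j : nat) u g : Prop :=
  [/\ loc_integrable Omega u, loc_integrable Omega g &
      forall phi, test_function Omega phi ->
        \int[leb2]_(p in Omega) (u p * iter i pdt (iter j pdx phi) p) =
        (-1) ^+ (i + j) * \int[leb2]_(p in Omega) (g p * phi p)].

(* L^1([0,T]; L^oo(R)), read as a mixed-norm space: g is jointly measurable and
   t |-> || g(t, .) ||_oo has finite integral over [0, T]. *)
Definition L1Linfty T g : Prop :=
  measurable_fun (slab T : set (measurableTypeR R * measurableTypeR R)) g /\
  (\int[leb1]_(t in `[0%R, T])
     'N[leb1]_(+oo) [ (fun x : R => (g (t, x))%:E) ] < +oo)%E.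

End SpaceTime.

(* Main.v *)
(* Write [u] for [um] and [v] for [up], and mollify both in time and space at
   scale [d].  Since [u] is continuous and [dxx u] lies in L^1 L^oo, freezing the
   coefficient costs little: the mollified functions [U], [V] satisfy classically
     U_t <= U U_xx / 2 + eta al(t) / 2,  V_t >= V V_xx / 2 - eta al(t) / 2,
   where [eta] is a modulus of continuity and [al] is a time mollification of the
   L^1 function [a] bounding [dxx u] and [dxx v].  As
   U U_xx - V V_xx = (U - V) V_xx + U (U - V)_xx, the function
     exp(- int al / 2) (U - V) - eta int al - eps exp(K t) (1 + x^2)^2
   obeys the classical maximum principle on a rectangle.  The barrier dominates at
   infinity because [u] grows at most quadratically: the weighted bound on [dt u]
   bounds the oscillation of [u(., x)] by a multiple of 1 + x^2, and a time average
   of [u] has bounded second derivative in [x].  Finally [d], [eta] and [eps]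
   tend to 0. *)
Require Import Defs.
From mathcomp Require Import all_boot all_order all_algebra.
From mathcomp Require Import all_classical all_reals all_analysis.
From mathcomp Require Import measurable_realfun ess_sup_inf ring lra.
Import Order.TTheory GRing.Theory Num.Theory.
Import numFieldNormedType.Exports.

Set Implicit Arguments.
Unset Strict Implicit.
Unset Printing Implicit Defensive.

Local Open Scope classical_set_scope.
Local Open Scope ring_scope.

(** * Smooth step functions *)

Section Smooth.
Context {R : realType}.
Implicit Types (f g df : R -> R) (x a b c d : R) (k n : nat).

(** The mollifier is the derivative [th'] of a smooth step [th], which pays twice. Convolving [a]
    with [th] itself gives an explicit primitive of [al], bounded by the integral of [a] whatever
    [d] is, so the constants survive the limit in [d]. And the difference of two time mollifications
    of [u] is an integral of [u] against minus the derivative of [th(t - s) - th(t' - s)], a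
    compactly supported function with values in [0, 1]; the weak derivative [dt u] then bounds it by
    the integral of its L^1 majorant. The barrier has to beat quadratic growth with an arbitrarily
    small factor, while [U psi'' / 2] must stay below a multiple of [psi]. The polynomial
    [psi = (1 + x^2)^2] does both: quadratic [U] times quadratic [psi''] has the order of [psi]. The
    term [(U - V) Vxx] is bounded by [al (U - V)] only where [U >= V]. The maximum principle is
    therefore run above the level [2 eta], where this sign is automatic. *)

Fixpoint smoothn k f : Prop :=
  if k is k'.+1 then (forall x, derivable f x 1) /\ smoothn k' (derive1 f)
  else continuous f.

Lemma derive1_is_derive f x d : is_derive x 1 f d -> derive1 f x = d.
Proof. by move=> fdf; rewrite derive1E derive_val. Qed.

Lemma is_derive_derive1 f x : derivable f x 1 -> is_derive x 1 f (derive1 f x).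
Proof. by move=> df; rewrite derive1E; exact: derivableP. Qed.

Lemma derivable_continuous f : (forall x, derivable f x 1) -> continuous f.
Proof.
by move=> df x; apply/differentiable_continuous/derivable1_diffP; exact: df.
Qed.

Lemma smoothnS k f df : (forall x, is_derive x 1 f (df x)) ->
  smoothn k df -> smoothn k.+1 f.
Proof.
move=> fdf sdf; split=> [x|]; first by case: (fdf x).
suff -> : derive1 f = df by [].
by apply/funext => x; exact: derive1_is_derive.
Qed.

Lemma smoothn_is_derive k f x : smoothn k.+1 f -> is_derive x 1 f (derive1 f x).
Proof. by case=> df _; exact: is_derive_derive1. Qed.

Lemma smoothnW k f : smoothn k.+1 f -> smoothn k f.
Proof.
elim: k f => [f [df _]|k ih f [df /ih]]; first exact: derivable_continuous.
by split.
Qed.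

Lemma smoothn_continuous k f : smoothn k f -> continuous f.
Proof. by elim: k => // k ih /smoothnW. Qed.

Lemma smoothn_cst k c : smoothn k (cst c).
Proof.
elim: k c => [|k ih] c; first exact: cst_continuous.
by apply: (smoothnS (df := cst 0)) => // x; exact: is_derive_cst.
Qed.

Lemma smoothnD k f g : smoothn k f -> smoothn k g ->
  smoothn k (fun x => f x + g x).
Proof.
elim: k f g => [|k ih] f g.
  by move=> cf cg x; apply: cvgD; [exact: cf|exact: cg].
move=> sf sg; apply: (smoothnS (df := fun x => derive1 f x + derive1 g x)).
  move=> x; have df := smoothn_is_derive x sf; have dg := smoothn_is_derive x sg.
  exact: is_deriveD.
by apply: ih; [exact: sf.2|exact: sg.2].
Qed.

Lemma is_derive_mul f g x a b : is_derive x 1 f a -> is_derive x 1 g b ->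
  is_derive x 1 (fun y => f y * g y) (f x * b + g x * a).
Proof. exact: is_deriveM. Qed.

Lemma smoothnM k f g : smoothn k f -> smoothn k g ->
  smoothn k (fun x => f x * g x).
Proof.
elim: k f g => [|k ih] f g.
  by move=> cf cg x; apply: cvgM; [exact: cf|exact: cg].
move=> sf sg; apply: smoothnS (fun x => is_derive_mul (smoothn_is_derive x sf)
  (smoothn_is_derive x sg)) _.
by apply: smoothnD; apply: ih; by [exact: smoothnW|apply: sf.2|apply: sg.2].
Qed.

Lemma smoothnV k f : (forall x, f x != 0) -> smoothn k f ->
  smoothn k (fun x => (f x)^-1).
Proof.
move=> f0; elim: k => [|k ih] sf.
  by move=> x; apply: cvgV; [exact: f0|exact: sf].
have d x : is_derive x 1 (fun x => (f x)^-1)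
    ((-1 * derive1 f x) * ((f x)^-1 * (f x)^-1)).
  apply: is_derive_eq (is_deriveV (f0 x) (smoothn_is_derive x sf)) _.
  by rewrite /GRing.scale/= -exprVn; ring.
apply: smoothnS d _.
apply: smoothnM; first by apply: smoothnM; [exact: smoothn_cst|exact: sf.2].
by have := ih (smoothnW sf); move=> ?; exact: smoothnM.
Qed.

Lemma is_derive_affine f a b x d : is_derive (a + b * x) 1 f d ->
  is_derive x 1 (fun y => f (a + b * y)) (b * d).
Proof.
move=> fd; have h : is_derive x 1 (fun y => a + b * y) b.
  have := is_deriveD (is_derive_cst a x (1 : R)) (is_deriveZ b (is_derive_id x 1)).
  by rewrite add0r /GRing.scale/= mulr1.
by rewrite mulrC; exact: (@is_derive1_comp _ f _ x d b fd h).
Qed.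

Lemma smoothn_affine k f a b : smoothn k f -> smoothn k (fun x => f (a + b * x)).
Proof.
elim: k f => [f cf x|k ih f sf].
  apply: (@continuous_comp _ _ _ (fun y => a + b * y) f); last exact: cf.
  by apply: cvgD; [exact: cvg_cst|apply: cvgM; [exact: cvg_cst|exact: cvg_id]].
apply: (smoothnS (df := fun x => b * (derive1 f) (a + b * x))).
  by move=> x; apply: is_derive_affine; exact: smoothn_is_derive sf.
apply: smoothnM; [exact: smoothn_cst|exact: ih sf.2].
Qed.

(** The classical [exp(-1/x)], extended by zero, with an extra factor [x^-n]: the family is closed
    under differentiation, so one induction proves all its members smooth. *)
Definition flat n x : R := if 0 < x then x^-1 ^+ n * expR (- x^-1) else 0.

Lemma flat_ge0 n x : 0 <= flat n x.
Proof.
rewrite /flat; case: ifPn => // x0.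
by rewrite mulr_ge0 ?expR_ge0 ?exprn_ge0// invr_ge0 ltW.
Qed.

(** The exponential of [1/x] dominates its Taylor term of degree [n + 2], two powers more than the
    factor [x^-n]. The square left over makes the difference quotient at 0 vanish. *)
Lemma flat_le n x : flat n x <= n.+2`!%:R * x ^+ 2.
Proof.
rewrite /flat; case: ifPn => [x0|_]; last by rewrite mulr_ge0// sqr_ge0.
rewrite expRN ler_pdivrMr ?expR_gt0//.
have y0 : 0 < x^-1 by rewrite invr_gt0.
have f0 : 0 < n.+2`!%:R :> R by rewrite ltr0n fact_gt0.
have := expR_ge1Dxn n.+1 (ltW y0).
rewrite -(ler_pM2l f0) => /(le_trans _) h.
have {}h : x^-1 ^+ n.+2 <= n.+2`!%:R * expR x^-1.
  by apply: h; rewrite mulrDr mulrCA divff ?gt_eqF// !mulr1 lerDr ltW.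
have x2 : 0 <= x ^+ 2 by rewrite sqr_ge0.
apply: le_trans (_ : x ^+ 2 * x^-1 ^+ n.+2 <= _); last first.
  by apply: le_trans (ler_wpM2l x2 h) _; rewrite mulrCA mulrA.
by rewrite -[n.+2]addn2 exprD mulrCA -exprMn divff ?gt_eqF// expr1n mulr1.
Qed.

Lemma is_derive_flat n x :
  is_derive x 1 (flat n) (- n%:R * flat n.+1 x + flat n.+2 x).
Proof.
have [x0|x0|->] := ltgtP x 0.
- apply: (@near_eq_is_derive _ _ _ (cst 0)).
    near=> y; rewrite /flat ltNge ltW//; near: y; exact: lt_nbhsl.
  by rewrite /flat !ltNge !(ltW x0)/= mulr0 addr0; exact: is_derive_cst.
- have dV : is_derive x 1 (fun y : R => y^-1) (- x ^- 2).
    have /(_ (lt0r_neq0 x0)) := @is_deriveV R id x 1 1.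
    by move=> /(_ (is_derive_id x 1)); rewrite /GRing.scale/= mulr1.
  have dE : is_derive x 1 (fun y => expR (- y^-1)) (expR (- x^-1) * x ^- 2).
    rewrite -[x ^- 2]opprK.
    exact: (@is_derive1_comp _ expR (fun y => - y^-1) x _ _ _ (is_deriveN dV)).
  have dX : is_derive x 1 (fun y => y^-1 ^+ n) ((n%:R * x^-1 ^+ n.-1) * - x ^- 2).
    by have := is_deriveX n dV; rewrite exprfctE.
  have := is_derive_mul dX dE.
  set d := (X in is_derive _ _ _ X); set d' := (X in _ -> is_derive _ _ _ X).
  have -> : d = d'.
    rewrite /d /d' /flat x0 -!exprVn; case: n {d d' dX} => [|n] /=.
      by rewrite !exprS; ring.
    by rewrite !exprS; ring.
  apply: near_eq_is_derive.
  by near=> y; rewrite /flat ifT//; near: y; exact: lt_nbhsr.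
- rewrite /flat ltxx mulr0 addr0.
  (* By [flat_le] the quotient at 0 is at most [(n+2)! |h|]. *)
  have c0 : h^-1 *: (flat n (h + 0) - flat n 0) @[h --> 0^'] --> (0 : R).
    apply/cvgrPdist_le => e e0.
    have M0 : 0 < n.+2`!%:R :> R by rewrite ltr0n fact_gt0.
    near=> h; rewrite sub0r normrN addr0 {2}/flat ltxx subr0 normrZ normfV.
    have h0 : 0 < `|h| by rewrite normr_gt0; near: h; exact: nbhs_dnbhs_neq.
    rewrite mulrC ler_pdivrMr// ger0_norm ?flat_ge0//.
    apply: le_trans (flat_le _ _) _.
    rewrite -normr_id -real_normK ?num_real// normr_id expr2 mulrA.
    rewrite ler_pM2r// mulrC -ler_pdivlMr//.
    near: h; apply: dnbhs0_le; exact: divr_gt0.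
  apply: DeriveDef.
    by apply/cvg_ex; exists 0; move: c0; under eq_fun do rewrite -[X in X + 0]mulr1.
  by rewrite -derive1E; apply/cvg_lim.
Unshelve. all: by end_near. Qed.

Lemma smoothn_flat k n : smoothn k (flat n).
Proof.
elim: k n => [|k ih] n.
  by apply: derivable_continuous => x; case: (is_derive_flat n x).
apply: smoothnS (is_derive_flat n) _.
apply: smoothnD (ih _); apply: smoothnM (ih _); exact: smoothn_cst.
Qed.

End Smooth.

Section SmoothStep.
Context {R : realType}.
Implicit Types (f g th : R -> R) (x r a b c d : R) (k n : nat).

Lemma smoothn_derive1 k f : smoothn k.+1 f -> smoothn k (derive1 f).
Proof. by case. Qed.

Lemma is_derive_add f g x a b : is_derive x 1 f a -> is_derive x 1 g b ->
  is_derive x 1 (fun y => f y + g y) (a + b).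
Proof. exact: is_deriveD. Qed.

Lemma is_derive_sub f g x a b : is_derive x 1 f a -> is_derive x 1 g b ->
  is_derive x 1 (fun y => f y - g y) (a - b).
Proof. exact: is_deriveB. Qed.

Lemma is_derive_inv f x t : f x != 0 -> is_derive x 1 f t ->
  is_derive x 1 (fun y => (f y)^-1) (- (f x) ^- 2 * t).
Proof. exact: is_deriveV. Qed.

Lemma is_derive_near_cst f x c : (\forall y \near x, f y = c) ->
  is_derive x 1 f 0.
Proof.
move=> fc; have := is_derive_cst c x (1 : R).
by apply: near_eq_is_derive; apply: filterS fc => y ->.
Qed.

Lemma is_derive_subl f c x d : is_derive (c - x) 1 f d ->
  is_derive x 1 (fun y => f (c - y)) (- d).
Proof.
move=> fd; have -> : (fun y => f (c - y)) = fun y => f (c + -1 * y).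
  by apply/funext => y; rewrite mulN1r.
by rewrite -[- d]mulN1r; apply: is_derive_affine; rewrite mulN1r.
Qed.

Lemma is_derive_subr f c x d : is_derive (x - c) 1 f d ->
  is_derive x 1 (fun y => f (y - c)) d.
Proof.
move=> fd; have -> : (fun y => f (y - c)) = fun y => f (- c + 1 * y).
  by apply/funext => y; rewrite mul1r addrC.
by rewrite -[d]mul1r; apply: is_derive_affine; rewrite mul1r addrC.
Qed.

Lemma smoothn_subl k f c : smoothn k f -> smoothn k (fun x => f (c - x)).
Proof.
move=> /(smoothn_affine c (-1)).
by under eq_fun do rewrite mulN1r.
Qed.

Definition step1 x : R := flat 0 (1 + x) / (flat 0 (1 + x) + flat 0 (1 - x)).

Lemma flat_gt0 n x : 0 < x -> 0 < flat n x.
Proof.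
by move=> x0; rewrite /flat x0 mulr_gt0 ?expR_gt0// exprn_gt0// invr_gt0.
Qed.

Lemma flat_eq0 n x : x <= 0 -> flat n x = 0.
Proof. by rewrite /flat ltNge => ->. Qed.

Lemma step1_den_gt0 x : 0 < flat 0 (1 + x) + flat 0 (1 - x).
Proof.
have [x0|x0] := lerP 0 x.
  by rewrite ltr_pwDl ?flat_ge0// flat_gt0//; lra.
by rewrite ltr_wpDl ?flat_ge0// flat_gt0//; lra.
Qed.

(* A smoothed Heaviside function at scale [d]; its derivative is the mollifier. *)
Definition smooth_step d th := [/\ forall k, smoothn k th,
  forall r, r <= - d -> th r = 0, forall r, d <= r -> th r = 1 &
  forall r, 0 <= derive1 th r].

Lemma smooth_step1 : smooth_step 1 step1.
Proof.
have sD k : smoothn k (fun x : R => flat 0 (1 + x)).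
  have := smoothn_affine 1 1 (smoothn_flat (R := R) k 0).
  by under eq_fun do rewrite mul1r.
have sB k : smoothn k (fun x : R => flat 0 (1 - x)).
  exact/smoothn_subl/smoothn_flat.
split=> [k|r r1|r r1|r].
- apply: (@smoothnM _ k _ _ (sD k)).
  apply: smoothnV; last exact: smoothnD (sD k) (sB k).
  by move=> x; rewrite gt_eqF// step1_den_gt0.
- by rewrite /step1 flat_eq0 ?mul0r//; lra.
- rewrite /step1 [flat 0 (1 - r)]flat_eq0 ?addr0 ?divff//; last by lra.
  by rewrite gt_eqF// flat_gt0//; lra.
have dD : is_derive r 1 (fun x : R => flat 0 (1 + x)) (flat 2 (1 + r)).
  have -> : (fun x : R => flat 0 (1 + x)) = fun x => flat 0 (1 + 1 * x).
    by under eq_fun do rewrite -[X in 1 + X]mul1r.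
  rewrite -[X in is_derive _ _ _ X]mul1r; apply: is_derive_affine.
  by have := is_derive_flat 0 (1 + 1 * r); rewrite oppr0 mul0r add0r mul1r.
have dB : is_derive r 1 (fun x : R => flat 0 (1 - x)) (- flat 2 (1 - r)).
  apply: is_derive_subl.
  by have := is_derive_flat 0 (1 - r); rewrite oppr0 mul0r add0r.
have D0 := step1_den_gt0 r.
have dDB := is_derive_add dD dB.
have ds := is_derive_mul dD (@is_derive_inv _ r _ (lt0r_neq0 D0) dDB).
rewrite (derive1_is_derive ds).
set a := flat 0 _; set b := flat 0 _.
set a' := flat 2 _; set b' := flat 2 _.
(* Quotient rule: the terms [a a'] cancel, and only products of nonnegative factors remain. *)
rewrite [X in 0 <= X](_ : _ = (a + b) ^- 2 * (a * b' + b * a')); last first.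
  by field; rewrite gt_eqF.
rewrite mulr_ge0//; first by rewrite invr_ge0 exprn_ge0// ltW.
by rewrite addr_ge0// mulr_ge0// flat_ge0.
Qed.

Lemma smooth_step_ex d : 0 < d -> exists th, smooth_step d th.
Proof.
move=> d0; exists (fun x => step1 (0 + d^-1 * x)).
have [s1 s10 s11 s1d] := smooth_step1.
split=> [k|r r1|r r1|r]; first exact: smoothn_affine.
- by apply: s10; rewrite add0r mulrC ler_pdivrMr// mulN1r.
- by apply: s11; rewrite add0r mulrC ler_pdivlMr// mul1r.
have ds := smoothn_is_derive (0 + d^-1 * r) (s1 1%N).
rewrite (derive1_is_derive (is_derive_affine ds)).
by rewrite mulr_ge0// invr_ge0 ltW.
Qed.

Definition supp_in a b f := forall r, ~~ (a <= r <= b) -> f r = 0.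

(** The complement of a closed interval is open, so [f] is locally zero there. *)
Lemma supp_in_derive1 a b f : supp_in a b f -> supp_in a b (derive1 f).
Proof.
move=> fab r; rewrite negb_and -!ltNge => rab; apply: derive1_is_derive.
apply: (is_derive_near_cst (c := 0)); case/orP : rab => [ra|br].
  near=> y; apply: fab; rewrite negb_and -ltNge; apply/orP; left.
  by near: y; exact: lt_nbhsl.
near=> y; apply: fab; rewrite negb_and -!ltNge; apply/orP; right.
by near: y; exact: lt_nbhsr.
Unshelve. all: by end_near. Qed.

Lemma supp_in_bounded a b f : continuous f -> supp_in a b f ->
  exists2 M, 0 <= M & forall r, `|f r| <= M.
Proof.
move=> cf sf.
have : bounded_set (f @` `[a, b]).
  apply: compact_bounded; apply: continuous_compact; last exact: segment_compact.
  exact: continuous_subspaceT.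
move=> [M [_ hM]]; exists (`|M| + 1); first by rewrite addr_ge0.
move=> r; have [dr|/sf->] := boolP (a <= r <= b); last first.
  by rewrite normr0 addr_ge0.
apply: (hM (`|M| + 1)) => /=; first by rewrite (le_lt_trans (ler_norm M))// ltrDl.
by exists r => //; rewrite /= in_itv.
Qed.

Lemma supp_in_subl a b c f : supp_in a b f ->
  supp_in (c - b) (c - a) (fun s => f (c - s)).
Proof.
move=> fab r h; apply: fab; apply: contra h => /andP[h1 h2].
by apply/andP; split; lra.
Qed.

Lemma supp_inW a b a' b' f : supp_in a b f -> a' <= a -> b <= b' ->
  supp_in a' b' f.
Proof.
move=> fab aa bb r h; apply: fab; apply: contra h => /andP[h1 h2].
by apply/andP; split; lra.
Qed.

Section StepTheory.
Variables (d : R) (th : R -> R) (step : smooth_step d th).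

Lemma step_smooth k : smoothn k th. Proof. by case: step. Qed.

Lemma step_kernel_smooth k : smoothn k (derive1 th).
Proof. by have [/(_ k.+1)[]] := step. Qed.

Lemma step_is_derive x : is_derive x 1 th (derive1 th x).
Proof. exact: smoothn_is_derive (step_smooth 1). Qed.

Lemma step_kernel_ge0 r : 0 <= derive1 th r. Proof. by case: step. Qed.

Lemma step_kernel_supp : supp_in (- d) d (derive1 th).
Proof.
move=> r; rewrite negb_and -!ltNge orbC => /orP[dr|dr].
  apply: derive1_is_derive.
  apply: (is_derive_near_cst (c := 1)).
  have [_ _ th1 _] := step.
  by near=> y; rewrite th1//; apply/ltW; near: y; exact: lt_nbhsr.
apply: derive1_is_derive.
apply: (is_derive_near_cst (c := 0)).
have [_ th0 _ _] := step.
near=> y; rewrite th0//; apply/ltW; near: y; exact: lt_nbhsl.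
Unshelve. all: by end_near. Qed.

Lemma step_le x y : x <= y -> th x <= th y.
Proof.
move=> xy; have [//||z _ h] := @MVT_segment R th (derive1 th) x y xy.
- by move=> z _; exact: step_is_derive.
- exact/continuous_subspaceT/smoothn_continuous/(step_smooth 0).
by rewrite -subr_ge0 h mulr_ge0 ?step_kernel_ge0// subr_ge0.
Qed.

Lemma step_itv x : 0 <= th x <= 1.
Proof.
have [_ th0 th1 _] := step; apply/andP; split.
  (* By monotonicity it is enough to compare with a point left of both [x] and [- d], where the step
     is 0; the upper bound is symmetric. *)
  by rewrite -(th0 (Num.min x (- d))) ?ge_min ?lexx ?orbT// step_le// ge_min lexx.
by rewrite -(th1 (Num.max x d)) ?le_max ?lexx ?orbT// step_le// le_max lexx.
Qed.

End StepTheory.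
End SmoothStep.

(** * Comparison of integrals and differentiation under the integral sign *)

Section IntegralLemmas.
Context d (Y : measurableType d) (R : realType).
Variable mu : {measure set Y -> \bar R}.
Implicit Types (f g u m : Y -> R) (B K : set Y) (M : R).

(** Almost everywhere on [B], [g - f] equals its absolute value, whose integral is nonnegative. *)
Lemma ae_le_Rintegral B f g : measurable B ->
  mu.-integrable B (EFin \o f) -> mu.-integrable B (EFin \o g) ->
  {ae mu, forall y, B y -> f y <= g y} ->
  \int[mu]_(y in B) f y <= \int[mu]_(y in B) g y.
Proof.
move=> mB intf intg fg; rewrite -subr_ge0 -RintegralB//.
have intgf : mu.-integrable B (EFin \o (fun y => g y - f y)).
  have := integrableB mB intg intf.
  by apply: eq_integrable => // y _; rewrite /= EFinB.
suff -> : \int[mu]_(y in B) (g y - f y) = \int[mu]_(y in B) `|g y - f y|.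
  by apply: Rintegral_ge0 => y _.
congr fine; apply: ae_eq_integral => //.
- exact: measurable_int intgf.
- exact: measurable_int (integrable_norm intgf).
- by apply: filterS fg => y h By; rewrite ger0_norm// subr_ge0 h.
Qed.

(** For a merely locally integrable [u], the compact support of a test function does the work:
    [M |u|] on [K] is an integrable majorant. *)
Lemma integrable_mul_supp B K u m M : measurable B -> measurable K -> K `<=` B ->
  mu.-integrable K (EFin \o u) -> measurable_fun B u -> measurable_fun B m ->
  (forall y, B y -> `|m y| <= M) -> (forall y, B y -> ~ K y -> m y = 0) ->
  mu.-integrable B (EFin \o (fun y => u y * m y)).
Proof.
move=> mB mK KB intu mu_ mm mM m0.
have intK : mu.-integrable B (fun y => M%:E * ((EFin \o u) \_ K) y)%E.
  apply: integrableZl => //; apply/integrable_restrict => //.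
  by rewrite (setIidr KB).
apply: le_integrable intK => //.
  by apply/measurable_EFinP; exact: measurable_funM.
move=> y By; have [yK|yK] := pselect (K y); last first.
  by rewrite /= m0// mulr0 normr0 abse_ge0.
rewrite patchE mem_set//= lee_fin !normrM mulrC ler_wpM2r//.
exact: le_trans (mM y By) (ler_norm M).
Qed.

(** A single majorant, [|M| |u|] on [K], serves every parameter in []a, b[]; hence one set [K] has
    to contain the supports for all of them. *)
Lemma is_derive_Rintegral B K u (m m' : R -> Y -> R) M (a b z : R) :
  measurable B -> measurable K -> K `<=` B -> z \in `]a, b[ ->
  mu.-integrable K (EFin \o u) -> measurable_fun B u ->
  (forall s, measurable_fun B (m s)) ->
  (forall s y, s \in `]a, b[ -> B y -> is_derive s 1 (m ^~ y) (m' s y)) ->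
  (forall s y, s \in `]a, b[ -> B y -> `|m s y| <= M) ->
  (forall s y, s \in `]a, b[ -> B y -> `|m' s y| <= M) ->
  (forall s y, s \in `]a, b[ -> B y -> ~ K y -> m s y = 0) ->
  (forall s y, s \in `]a, b[ -> B y -> ~ K y -> m' s y = 0) ->
  is_derive z 1 (fun s => \int[mu]_(y in B) (u y * m s y))
    (\int[mu]_(y in B) (u y * m' z y)).
Proof.
move=> mB mK KB abz intu mu_ mm dm mM mM' m0 m0'.
pose G y := `|M| * (`|u y| * \1_K y).
have dum s y : s \in `]a, b[ -> B y ->
    is_derive s 1 (fun s => u y * m s y) (u y * m' s y).
  by move=> abs By; have := is_deriveZ (u y) (dm s y abs By).
have d1E s y : s \in `]a, b[ -> B y ->
    partial1of2 (fun s y => u y * m s y) s y = u y * m' s y.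
  by move=> abs By; apply: derive1_is_derive; exact: dum.
have intum s : s \in `]a, b[ -> mu.-integrable B (EFin \o (fun y => u y * m s y)).
  move=> abs; apply: (@integrable_mul_supp B K u (m s) M) => //.
  - by move=> y; exact: mM.
  - by move=> y; exact: m0.
have dumb s y : s \in `]a, b[ -> B y -> derivable (fun s => u y * m s y) s 1.
  by move=> abs By; case: (dum s y abs By).
have G0 y : 0 <= G y by rewrite !mulr_ge0.
have intG : mu.-integrable B (EFin \o G).
  have h : mu.-integrable B (fun y => `|M|%:E * ((EFin \o (Num.norm \o u)) \_ K) y)%E.
    apply: integrableZl => //; apply/integrable_restrict => //.
    by rewrite (setIidr KB); exact: integrable_norm.
  apply: eq_integrable h => // y _; rewrite patchE /= /G indicE.
  by case: (y \in K); rewrite /= ?mulr1 ?mulr0 ?mule0 ?EFinM.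
have Gub s y : s \in `]a, b[ -> B y ->
    `|partial1of2 (fun s y => u y * m s y) s y| <= G y.
  move=> abs By; rewrite d1E// /G normrM indicE.
  have [Ky|Ky] := pselect (K y).
    rewrite mem_set// mulr1 mulrC ler_wpM2r//.
    exact: le_trans (mM' s y abs By) (ler_norm M).
  by rewrite m0'// normr0 mulr0 memNset// !mulr0.
have D := derivable_under_integral mB abz intum dumb G0 intG Gub.
have E := differentiation_under_integral mB abz intum dumb G0 intG Gub.
have -> : \int[mu]_(y in B) (u y * m' z y) =
    derive1 (fun s => \int[mu]_(y in B) (u y * m s y)) z.
  by rewrite E; apply: eq_Rintegral => y /set_mem By; rewrite d1E.
exact: is_derive_derive1.
Qed.

End IntegralLemmas.

(** * Tensor test functions and weak derivatives *)

Section Tensor.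
Context {R : realType}.
Implicit Types (f g u h : R -> R) (a b c d T : R) (k : nat) (Omega : set (R * R)).

(** The mollifying kernel is a product of a time kernel and a space kernel, so the weak derivatives
    are only ever tested on such products. *)
Definition tens f g : R * R -> R := fun p => f p.1 * g p.2.

Definition box a b c d : set (R * R) := `[a, b] `*` `[c, d].

Lemma pdt_tens f g : (forall x, derivable f x 1) ->
  pdt (tens f g) = tens (derive1 f) g.
Proof.
move=> df; apply/funext => p; rewrite /pdt /tens /=.
by rewrite derive1Mr.
Qed.

Lemma pdx_tens f g : (forall x, derivable g x 1) ->
  pdx (tens f g) = tens f (derive1 g).
Proof.
move=> dg; apply/funext => p; rewrite /pdx /tens /=.
by rewrite derive1Ml.
Qed.

Lemma continuous_tens f g : continuous f -> continuous g -> continuous (tens f g).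
Proof.
move=> cf cg p; apply: cvgM.
  by apply: (@continuous_comp _ _ _ fst f); [exact: cvg_fst|exact: cf].
by apply: (@continuous_comp _ _ _ snd g); [exact: cvg_snd|exact: cg].
Qed.

Lemma Ck_tens k f g : smoothn k f -> smoothn k g -> Ck k (tens f g).
Proof.
elim: k f g => [|k ih] f g sf sg; first exact: continuous_tens.
split=> [p|p|||].
- apply: (@derivableM _ _ f (cst (g p.2))); first by have [] := sf.
  exact: derivable_cst.
- apply: (@derivableM _ _ (cst (f p.1)) g); last by have [] := sg.
  exact: derivable_cst.
- by apply: continuous_tens; apply: smoothn_continuous; [exact: sf|exact: sg].
- by rewrite pdt_tens; [apply: ih; [exact: sf.2|exact: smoothnW]|exact: sf.1].
- by rewrite pdx_tens; [apply: ih; [exact: smoothnW|exact: sg.2]|exact: sg.1].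
Qed.

Lemma compact_box a b c d : compact (box a b c d).
Proof. by apply: compact_setX; exact: segment_compact. Qed.

Lemma closed_box a b c d : closed (box a b c d).
Proof. by apply: compact_closed; [exact: norm_hausdorff|exact: compact_box]. Qed.

Lemma measurable_box a b c d :
  measurable (box a b c d : set (measurableTypeR R * measurableTypeR R)).
Proof. by apply: measurableX; exact: measurable_itv. Qed.

Lemma measurable_open_slab T :
  measurable (open_slab T : set (measurableTypeR R * measurableTypeR R)).
Proof. by apply: measurableX; [exact: measurable_itv|exact: measurableT]. Qed.

Lemma measurable_slab T :
  measurable (slab T : set (measurableTypeR R * measurableTypeR R)).
Proof. by apply: measurableX; [exact: measurable_itv|exact: measurableT]. Qed.

Lemma box_open_slab T a b c d : 0 < a -> b < T ->
  box a b c d `<=` open_slab T.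
Proof.
move=> a0 bT p [/= + _]; rewrite in_itv/= => /andP[ap pb]; split => //=.
by rewrite in_itv/= (lt_le_trans a0 ap) (le_lt_trans pb bT).
Qed.

Lemma tens_supp a b c d f g p : supp_in a b f -> supp_in c d g ->
  ~ box a b c d p -> tens f g p = 0.
Proof.
move=> sf sg np; rewrite /tens.
have [ab|/sf->] := boolP (a <= p.1 <= b); last by rewrite mul0r.
have [cd|/sg->] := boolP (c <= p.2 <= d); last by rewrite mulr0.
by exfalso; apply: np; split => /=; rewrite in_itv.
Qed.

Lemma test_function_tens Omega a b c d f g :
  (forall k, smoothn k f) -> (forall k, smoothn k g) ->
  supp_in a b f -> supp_in c d g -> box a b c d `<=` Omega ->
  test_function Omega (tens f g).
Proof.
move=> sf sg fab gcd sub.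
have cl : closure [set p | tens f g p != 0] `<=` box a b c d.
  rewrite (closure_id (box a b c d)).1; last exact: closed_box.
  apply: closure_subset => p /= /eqP np.
  by apply: contrapT => /(tens_supp fab gcd).
split; first by move=> k; exact: Ck_tens.
  apply: subclosed_compact cl; [exact: closed_closure|exact: compact_box].
exact: subset_trans sub.
Qed.

Lemma measurable_tens f g (D : set (measurableTypeR R * measurableTypeR R)) :
  continuous f -> continuous g -> measurable_fun D (tens f g).
Proof.
move=> cf cg; apply: measurable_funS (_ : measurable_fun setT _) => //.
apply: measurable_funM.
  by apply: measurableT_comp; [exact: continuous_measurable_fun|exact: measurable_fst].
by apply: measurableT_comp; [exact: continuous_measurable_fun|exact: measurable_snd].
Qed.

Lemma tens_bounded a b c d f g : continuous f -> continuous g ->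
  supp_in a b f -> supp_in c d g -> exists2 M, 0 <= M & forall p, `|tens f g p| <= M.
Proof.
move=> cf cg sf sg.
have [M M0 fM] := supp_in_bounded cf sf; have [N N0 gN] := supp_in_bounded cg sg.
by exists (M * N); [exact: mulr_ge0|move=> p; rewrite normrM ler_pM].
Qed.

Lemma integrable_mul_tens T a b c d (w : R * R -> R) f g :
  loc_integrable (open_slab T) w -> 0 < a -> b < T ->
  continuous f -> continuous g -> supp_in a b f -> supp_in c d g ->
  leb2.-integrable (open_slab T) (EFin \o (fun p => w p * tens f g p)).
Proof.
move=> [mw iw] a0 bT cf cg sf sg.
have [M _ hM] := tens_bounded cf cg sf sg.
apply: (@integrable_mul_supp _ _ _ leb2 (open_slab T) (box a b c d) w (tens f g) M) => //.
- exact: measurable_open_slab.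
- exact: measurable_box.
- exact: box_open_slab.
- by apply: iw; [exact: compact_box|exact: box_open_slab].
- exact: measurable_tens.
- by move=> p _; exact: tens_supp.
Qed.

Lemma weak_dt_tens T a b c d (w wt : R * R -> R) f g :
  weak_derivative (open_slab T) 1 0 w wt -> 0 < a -> b < T ->
  (forall k, smoothn k f) -> (forall k, smoothn k g) ->
  supp_in a b f -> supp_in c d g ->
  \int[leb2]_(p in open_slab T) (w p * tens (derive1 f) g p) =
  - \int[leb2]_(p in open_slab T) (wt p * tens f g p).
Proof.
move=> [_ _ H] a0 bT sf sg fab gcd.
have := H _ (test_function_tens sf sg fab gcd (box_open_slab a0 bT)).
by rewrite /= pdt_tens ?expr1 ?mulN1r; last exact: (sf 1%N).1.
Qed.

Lemma weak_dxx_tens T a b c d (w wxx : R * R -> R) f g :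
  weak_derivative (open_slab T) 0 2 w wxx -> 0 < a -> b < T ->
  (forall k, smoothn k f) -> (forall k, smoothn k g) ->
  supp_in a b f -> supp_in c d g ->
  \int[leb2]_(p in open_slab T) (w p * tens f (derive1 (derive1 g)) p) =
  \int[leb2]_(p in open_slab T) (wxx p * tens f g p).
Proof.
move=> [_ _ H] a0 bT sf sg fab gcd.
have := H _ (test_function_tens sf sg fab gcd (box_open_slab a0 bT)).
rewrite /= pdx_tens; last exact: (sg 1%N).1.
rewrite pdx_tens; last exact: (sg 2%N).2.1.
by rewrite sqrrN expr1n mul1r.
Qed.

(** The parameter sits in the kernel alone, so local integrability of [w] is enough. *)
Lemma is_derive_conv_t T (w : R * R -> R) (ka l : R -> R) a b c d (t : R) :
  loc_integrable (open_slab T) w ->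
  smoothn 1 ka -> continuous l -> supp_in a b ka -> supp_in c d l ->
  0 < t - b -> t - a < T ->
  is_derive t 1
    (fun s => \int[leb2]_(p in open_slab T) (w p * tens (fun r => ka (s - r)) l p))
    (\int[leb2]_(p in open_slab T)
      (w p * tens (fun r => derive1 ka (t - r)) l p)).
Proof.
move=> [mw iw] ska cl sk sl tb ta.
have [cka cka'] : continuous ka /\ continuous (derive1 ka).
  by split; [exact: smoothn_continuous ska|exact: ska.2].
have [M M0 kaM] := supp_in_bounded cka sk.
have [M' M'0 kaM'] := supp_in_bounded cka' (supp_in_derive1 sk).
have [N N0 lN] := supp_in_bounded cl sl.
(* Half of the room left inside the slab: for [s] within [e] of [t] all supports lie in one compact
   box of the open slab. *)
pose e : R := Num.min (t - b) (T - (t - a)) / 2.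
have e0 : 0 < e by rewrite divr_gt0// lt_min tb subr_gt0.
have eb : e < t - b.
  by rewrite ltr_pdivrMr// (le_lt_trans (y := t - b))// ?ge_min ?lexx//; lra.
have ea : e < T - (t - a).
  rewrite ltr_pdivrMr// (le_lt_trans (y := T - (t - a)))//.
    by rewrite ge_min lexx orbT.
  by lra.
pose K := box (t - e - b) (t + e - a) c d.
have KT : K `<=` open_slab T by apply: box_open_slab; lra.
have outK (h : R -> R) (s : R) (p : R * R) : supp_in a b h -> s \in `]t - e, t + e[ -> ~ K p ->
    tens (fun r => h (s - r)) l p = 0.
  move=> sk'; rewrite in_itv/= => /andP[s1 s2]; apply: (@tens_supp (t - e - b) (t + e - a) c d) => //.
  by apply: supp_inW (supp_in_subl (c := s) sk') _ _; lra.
have csub (h : R -> R) (s : R) : continuous h -> continuous (fun r => h (s - r)).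
  move=> ch r; apply: (@continuous_comp _ _ _ (fun r => s - r) h); last exact: ch.
  by apply: cvgB; [exact: cvg_cst|exact: cvg_id].
apply: (@is_derive_Rintegral _ _ _ leb2 (open_slab T) K w
  (fun s p => tens (fun r => ka (s - r)) l p)
  (fun s p => tens (fun r => derive1 ka (s - r)) l p)
  ((M + M') * N) (t - e) (t + e)) => //.
- exact: measurable_open_slab.
- exact: measurable_box.
- by rewrite in_itv/=; apply/andP; split; lra.
- by apply: iw => //; exact: compact_box.
- by move=> s; apply: measurable_tens => //; exact: csub.
- move=> s p _ _; rewrite /tens.
  have dka := is_derive_subr (c := p.1) (smoothn_is_derive (s - p.1) ska).
  apply: is_derive_eq (is_derive_mul dka (is_derive_cst (l p.2) s 1)) _.
  by rewrite mulr0 add0r mulrC.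
- move=> s p _ _; rewrite normrM ler_pM//.
  by apply: (le_trans (kaM _)); rewrite lerDl.
- move=> s p _ _; rewrite normrM ler_pM//.
  by apply: (le_trans (kaM' _)); rewrite lerDr.
- by move=> s p si _; exact: outK.
- by move=> s p si _; apply: outK => //; exact: supp_in_derive1.
Qed.

Lemma is_derive_conv_x T (w : R * R -> R) (k la : R -> R) a b c d (x : R) :
  loc_integrable (open_slab T) w ->
  continuous k -> smoothn 1 la -> supp_in a b k -> supp_in c d la ->
  0 < a -> b < T ->
  is_derive x 1
    (fun y => \int[leb2]_(p in open_slab T) (w p * tens k (fun r => la (y - r)) p))
    (\int[leb2]_(p in open_slab T)
      (w p * tens k (fun r => derive1 la (x - r)) p)).
Proof.
move=> [mw iw] ck sla sk sl a0 bT.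
have [cla cla'] : continuous la /\ continuous (derive1 la).
  by split; [exact: smoothn_continuous sla|exact: sla.2].
have [M M0 laM] := supp_in_bounded cla sl.
have [M' M'0 laM'] := supp_in_bounded cla' (supp_in_derive1 sl).
have [N N0 kN] := supp_in_bounded ck sk.
pose K := box a b (x - 1 - d) (x + 1 - c).
have KT : K `<=` open_slab T by exact: box_open_slab.
have outK (h : R -> R) (s : R) (p : R * R) : supp_in c d h -> s \in `]x - 1, x + 1[ -> ~ K p ->
    tens k (fun r => h (s - r)) p = 0.
  move=> s'l; rewrite in_itv/= => /andP[s1 s2]; apply: (@tens_supp a b (x - 1 - d) (x + 1 - c)) => //.
  by apply: supp_inW (supp_in_subl (c := s) s'l) _ _; lra.
have csub (h : R -> R) (s : R) : continuous h -> continuous (fun r => h (s - r)).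
  move=> ch r; apply: (@continuous_comp _ _ _ (fun r => s - r) h); last exact: ch.
  by apply: cvgB; [exact: cvg_cst|exact: cvg_id].
apply: (@is_derive_Rintegral _ _ _ leb2 (open_slab T) K w
  (fun s p => tens k (fun r => la (s - r)) p)
  (fun s p => tens k (fun r => derive1 la (s - r)) p)
  (N * (M + M')) (x - 1) (x + 1)) => //.
- exact: measurable_open_slab.
- exact: measurable_box.
- by rewrite in_itv/=; apply/andP; split; lra.
- by apply: iw => //; exact: compact_box.
- by move=> s; apply: measurable_tens => //; exact: csub.
- move=> s p _ _.
  exact: (is_deriveZ (k p.1) (is_derive_subr (c := p.2) (smoothn_is_derive (s - p.2) sla))).
- move=> s p _ _; rewrite normrM ler_pM//.
  by apply: (le_trans (laM _)); rewrite lerDl.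
- move=> s p _ _; rewrite normrM ler_pM//.
  by apply: (le_trans (laM' _)); rewrite lerDr.
- by move=> s p si _; exact: outK.
- by move=> s p si _; apply: outK => //; exact: supp_in_derive1.
Qed.

Lemma derive1_subl n f c : smoothn n.+1 f ->
  derive1 (fun s => f (c - s)) = fun s => - derive1 f (c - s).
Proof.
move=> sf; apply/funext => s; apply: derive1_is_derive; apply: is_derive_subl.
exact: (smoothn_is_derive _ sf).
Qed.

(** The minus sign in the weak derivative cancels the one from differentiating [f (t - s)] in [s],
    so derivatives pass from the kernel to [w] unchanged. *)
Lemma weak_dt_conv T a b c d t x (w wt : R * R -> R) f g :
  weak_derivative (open_slab T) 1 0 w wt -> 0 < t - b -> t - a < T ->
  (forall n, smoothn n f) -> (forall n, smoothn n g) ->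
  supp_in a b f -> supp_in c d g ->
  \int[leb2]_(p in open_slab T)
    (w p * tens (fun s => derive1 f (t - s)) (fun y => g (x - y)) p) =
  \int[leb2]_(p in open_slab T)
    (wt p * tens (fun s => f (t - s)) (fun y => g (x - y)) p).
Proof.
move=> wd a0 bT sf sg fab gcd.
have st j : smoothn j (fun s => f (t - s)) by exact: smoothn_subl (sf j).
have sx j : smoothn j (fun y => g (x - y)) by exact: smoothn_subl (sg j).
have W := weak_dt_tens wd a0 bT st sx (supp_in_subl fab) (supp_in_subl gcd).
apply/oppr_inj; rewrite -[RHS]W (derive1_subl t (sf 1%N)).
rewrite -[LHS]mulN1r -RintegralZl.
- by apply: eq_Rintegral => p _; rewrite /tens mulN1r mulNr mulrN.
- exact: measurable_open_slab.
have [lw _ _] := wd; apply: (integrable_mul_tens lw a0 bT).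
- exact: smoothn_continuous (smoothn_subl t (smoothn_derive1 (sf 1%N))).
- exact: (smoothn_continuous (sx 0%N)).
- exact: (supp_in_subl (supp_in_derive1 fab)).
- exact: (supp_in_subl gcd).
Qed.

Lemma weak_dxx_conv T a b c d t x (w wxx : R * R -> R) f g :
  weak_derivative (open_slab T) 0 2 w wxx -> 0 < t - b -> t - a < T ->
  (forall n, smoothn n f) -> (forall n, smoothn n g) ->
  supp_in a b f -> supp_in c d g ->
  \int[leb2]_(p in open_slab T)
    (w p * tens (fun s => f (t - s)) (fun y => derive1 (derive1 g) (x - y)) p) =
  \int[leb2]_(p in open_slab T)
    (wxx p * tens (fun s => f (t - s)) (fun y => g (x - y)) p).
Proof.
move=> wd a0 bT sf sg fab gcd.
have st j : smoothn j (fun s => f (t - s)) by exact: smoothn_subl (sf j).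
have sx j : smoothn j (fun y => g (x - y)) by exact: smoothn_subl (sg j).
have W := weak_dxx_tens wd a0 bT st sx (supp_in_subl fab) (supp_in_subl gcd).
rewrite -[RHS]W (derive1_subl x (sg 1%N)).
suff -> : derive1 (fun y => - derive1 g (x - y)) =
  fun y => derive1 (derive1 g) (x - y) by [].
apply/funext => s; apply: derive1_is_derive; rewrite -[derive1 (derive1 g) _]opprK.
apply: is_deriveN; apply: is_derive_subl.
exact: (smoothn_is_derive _ (smoothn_derive1 (sg 2%N))).
Qed.

End Tensor.

(** * The mixed norm and convolutions *)

Section MixedNorm.
Context {R : realType}.
Implicit Types (f g k a : R -> R) (T : R) (w : R * R -> R).
Local Notation mu1 := (@lebesgue_measure R).

(** The essential supremum exceeds [c] exactly when the section of [|w| > c] has positive measure,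
    and the measure of the sections of a measurable set is a measurable function. *)
Lemma measurable_ess_sup_slice (w : measurableTypeR R * measurableTypeR R -> R) :
  measurable_fun setT w ->
  measurable_fun (setT : set (measurableTypeR R))
    (fun t => ess_sup mu1 (fun x => `|w (t, x)|%:E)).
Proof.
move=> mw.
apply: (measurability _ (ErealGenOInfty.measurableE R)) => // _ [_ [c ->] <-].
rewrite setTI.
pose G : set (measurableTypeR R * measurableTypeR R) := [set p | c < `|w p|].
have mG : measurable G.
  have -> : G = (fun p => `|w p|) @^-1` `]c, +oo[.
    by apply/seteqP; split=> p /=; rewrite in_itv/= andbT.
  rewrite -[X in measurable X]setTI.
  have mn : measurable_fun setT (fun p => `|w p|).
    by apply: measurableT_comp => //; exact: measurable_normr.
  by apply: mn => //; exact: measurable_itv.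
have mwt t : measurable_fun setT (fun x : measurableTypeR R => w (t, x)).
  exact: measurable_fun_pair2.
have E : (fun t => ess_sup mu1 (fun x => `|w (t, x)|%:E)) @^-1` `]c%:E, +oo[ =
    ~` ((mu1 \o xsection G) @^-1` [set 0%E]).
  apply/seteqP; split => t /=; rewrite in_itv/= andbT.
    move=> h h0; move: h; apply/negP; rewrite -leNgt; apply/ess_supP.
    apply/ae_le_measureP.
      by apply/measurable_EFinP; apply: measurableT_comp => //; exact: measurable_normr.
    rewrite -[RHS]h0; congr (mu1 _); apply/seteqP; split=> x /=.
      by rewrite in_itv/= andbT lte_fin xsectionE.
    by rewrite in_itv/= andbT lte_fin xsectionE.
  move=> h0; rewrite ltNge; apply/negP => /ess_supP h; apply: h0.
  have /ae_le_measureP : measurable_fun setT (fun x : measurableTypeR R => `|w (t, x)|%:E).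
    by apply/measurable_EFinP; apply: measurableT_comp => //; exact: measurable_normr.
  move=> /(_ mu1 c%:E)[+ _] => /(_ h) <-.
  congr (mu1 _); apply/seteqP; split=> x /=.
    by rewrite in_itv/= andbT lte_fin xsectionE.
  by rewrite in_itv/= andbT lte_fin xsectionE.
rewrite E; apply: measurableC; rewrite -[X in measurable X]setTI.
have mx := measurable_fun_xsection mu1 mG.
by apply: mx => //; exact: emeasurable_set1.
Qed.

(** Replaces the mixed norm by a real majorant depending on time only, which is the form used in
    every estimate below. For almost every time the bound holds for almost every [x]; Tonelli makes
    this one statement in the plane. *)
Lemma L1Linfty_dominated T w : L1Linfty T w ->
  exists a : R -> R, [/\ measurable_fun (setT : set (measurableTypeR R)) a,
    forall s, 0 <= a s, mu1.-integrable `]0, T[ (EFin \o a) &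
    {ae leb2, forall p : R * R, open_slab T p -> `|w p| <= a p.1}].
Proof.
move=> [mw intw].
(* Extension by zero gives measurability on the whole plane without changing the slices over
   [[0, T]]. *)
pose w0 : measurableTypeR R * measurableTypeR R -> R := w \_ (slab T).
have mw0 : measurable_fun setT w0.
  by apply/(measurable_restrictT _ _).1 => //; exact: measurable_slab.
have mN := measurable_ess_sup_slice mw0.
set N := fun t => _ in mN.
have mu1T : (0 < mu1 setT)%E.
  apply: (@lt_le_trans _ _ (mu1 `[0%R, 1%R])).
    by rewrite lebesgue_measure_itv/= lte_fin ltr01 -EFinB subr0 lte_fin.
  by apply: le_measure => //; rewrite inE; [exact: measurable_itv|exact: measurableT].
have N0 t : (0 <= N t)%E.
  apply: (@le_trans _ _ (ess_sup mu1 (cst 0%E))); first by rewrite ess_sup_cst.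
  by apply: le_ess_sup; apply: aeW => x /=; rewrite lee_fin.
have NE t : t \in `[0, T] -> Lnorm leb1 +oo%E (fun x : R => (w (t, x))%:E) = N t.
  move=> tT; rewrite unlock ifT//; congr (ess_sup _ _); apply/funext => x /=.
  by rewrite /w0 patchE mem_set.
have intN : (\int[mu1]_(t in `]0%R, T[) N t < +oo)%E.
  have E : (\int[leb1]_(t in `[0%R, T]) Lnorm leb1 +oo (fun x : R => (w (t, x))%:E) =
      \int[mu1]_(t in `[0%R, T]) N t)%E.
    by apply: eq_integral => t /set_mem tT; exact: NE.
  move: intw; rewrite E; apply: le_lt_trans.
  apply: ge0_subset_integral => //.
  - exact: measurable_funTS.
  - exact: subset_itv_oo_cc.
have mT : measurable (`]0%R, T[ : set (measurableTypeR R)) by exact: measurable_itv.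
have iN : mu1.-integrable `]0, T[ N.
  apply/integrableP; split; first exact: measurable_funTS.
  by under eq_integral do rewrite gee0_abs//.
have finN := integrable_ae mT iN.
(* [fine] sends [+oo] to 0, where the bound may fail; by [finN] such times form a null set. *)
pose a t := fine (N t).
have ma : measurable_fun (setT : set (measurableTypeR R)) a.
  by apply: measurableT_comp => //; exact: measurable_fine.
have a0 s : 0 <= a s by exact: fine_ge0.
exists a; split => //.
  apply: le_integrable iN => //.
    by apply/measurable_EFinP; exact: measurable_funTS.
  move=> t _; rewrite /= ger0_norm// gee0_abs// /a.
  by case: (N t) (N0 t) => //= _; rewrite leey.
(* [E] is the exceptional set: it is measurable and almost all its sections are null, so it is
   null. *)
pose E : set (measurableTypeR R * measurableTypeR R) :=
  open_slab T `&` [set p | a p.1 < `|w0 p|].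
have mE : measurable E.
  rewrite /E.
  have mlt : measurable_fun (open_slab T : set (measurableTypeR R * measurableTypeR R))
      (fun p => a p.1 < `|w0 p|).
    apply: measurable_fun_ltr.
      by apply: measurable_funTS; apply: measurableT_comp => //; exact: measurable_fst.
    by apply: measurable_funTS; apply: measurableT_comp => //; exact: measurable_normr.
  have := mlt (measurable_open_slab T) [set true] I.
  by congr (measurable _); apply/seteqP; split=> p /=.
exists E; split => //.
  have mx := measurable_fun_xsection mu1 mE.
  suff : (\int[mu1]_t (mu1 \o xsection E) t = 0)%E by [].
  transitivity (\int[mu1]_(t in setT) (cst 0 t : \bar R))%E; last exact: integral0.
  apply: ge0_ae_eq_integral => //.
  apply: filterS finN => t finNt _ /=.
  have [tT|tT] := boolP (t \in `]0, T[); last first.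
    rewrite (_ : xsection E t = set0) ?measure0//.
    by apply/seteqP; split=> x //=; rewrite xsectionE /E /= => -[[/= tT']]; rewrite tT' in tT.
  have h := ess_sup_ge mu1 (fun x => `|w0 (t, x)|%:E).
  have NtE : (a t)%:E = N t by rewrite fineK// finNt.
  apply: measure_negligible; first exact: measurable_xsection.
  apply: negligibleS h => x /=; rewrite xsectionE /E /= => -[_ ax].
  by apply/negP; rewrite -ltNge -/(N t) -NtE lte_fin.
move=> p /= /not_implyP[pT /negP]; rewrite -ltNge => h; split => //=.
rewrite /w0 patchE mem_set//; case: pT => pT _; split => //.
exact: subset_itv_oo_cc.
Qed.

End MixedNorm.

(** * Mollifying kernels and integrals of products *)

Section Convolution.
Context {R : realType}.
Implicit Types (f g k a th : R -> R) (T d x : R) (w : R * R -> R).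
Local Notation mu1 := (@lebesgue_measure R).

(** A primitive is [- th (x - y)], which climbs from -1 to 0 across [[x - d, x + d]]. *)
Lemma step_kernel_integral d th x (A : set (measurableTypeR R)) :
  0 < d -> smooth_step d th -> measurable A -> `[x - d, x + d] `<=` A ->
  (\int[mu1]_(y in A) (derive1 th (x - y))%:E = 1)%E.
Proof.
move=> d0 step mA sub.
have k_out y : ~ `[x - d, x + d]%classic y -> derive1 th (x - y) = 0.
  move=> h; apply: (step_kernel_supp step); apply/negP => /andP[h1 h2].
  by apply: h; rewrite /= in_itv/=; apply/andP; split; lra.
have -> : (\int[mu1]_(y in A) (derive1 th (x - y))%:E =
    \int[mu1]_(y in `[(x - d)%R, (x + d)%R]) (derive1 th (x - y))%:E)%E.
  rewrite integral_mkcond [RHS]integral_mkcond; apply: eq_integral => y _.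
  rewrite !patchE; case: ifPn => [|] yA; case: ifPn => // yI.
    by rewrite k_out//; move: yI; rewrite notin_setE.
  by exfalso; move: yA; rewrite notin_setE; apply; apply: sub; move/set_mem : yI.
have sk := smoothn_subl x (step_kernel_smooth step 0).
have sth := smoothn_subl x (step_smooth step 1).
have dF (y : R) : is_derive y 1 (fun y => - th (x - y)) (derive1 th (x - y)).
  have := is_deriveN (is_derive_subl (step_is_derive step (x - y))).
  by rewrite opprK.
have cF : continuous (fun y => - th (x - y)).
  by move=> y; apply: cvgN; exact: (smoothn_continuous sth).
rewrite (@continuous_FTC2 _ _ (fun y => - th (x - y))).
- have [_ th0 th1 _] := step.
  rewrite th0; last by lra.
  rewrite (th1 (x - (x - d))); last by lra.
  by rewrite -EFinB oppr0 sub0r opprK.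
- by lra.
- exact: continuous_subspaceT.
- split; first by move=> y _; case: (dF y).
    exact/cvg_at_right_filter/cF.
  exact/cvg_at_left_filter/cF.
- by move=> y _; exact: derive1_is_derive.
Qed.

(** All that later arguments need of a mollifier. The mass condition allows any [A] around the
    support, so that it covers both the whole line in space and []0, T[] in time. *)
Definition kernel d k := [/\ forall n, smoothn n k, supp_in (- d) d k,
  forall r, 0 <= k r & forall x (A : set (measurableTypeR R)),
    measurable A -> `[x - d, x + d] `<=` A ->
    (\int[mu1]_(y in A) (k (x - y))%:E = 1)%E].

Lemma step_kernel d th : 0 < d -> smooth_step d th -> kernel d (derive1 th).
Proof.
move=> d0 sth; split.
- exact: (step_kernel_smooth sth).
- exact: (step_kernel_supp sth).
- exact: (step_kernel_ge0 sth).
- by move=> x A; exact: (step_kernel_integral d0 sth).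
Qed.

Lemma integral_tens T a f g : measurable_fun (setT : set (measurableTypeR R)) a ->
  continuous f -> continuous g ->
  (forall s, 0 <= a s) -> (forall s, 0 <= f s) -> (forall y, 0 <= g y) ->
  (\int[leb2]_(p in open_slab T) (a p.1 * tens f g p)%:E =
  \int[mu1]_(s in `]0%R, T[) (a s * f s)%:E * \int[mu1]_y (g y)%:E)%E.
Proof.
move=> ma cf cg a0 f0 g0.
have mf : measurable_fun (setT : set (measurableTypeR R)) f.
  exact: continuous_measurable_fun.
have mg : measurable_fun (setT : set (measurableTypeR R)) g.
  exact: continuous_measurable_fun.
pose h (s : measurableTypeR R) : R := ((fun s => a s * f s) \_ `]0, T[) s.
have mh : measurable_fun setT h.
  apply/(measurable_restrictT _ _).1 => //.
  by apply: measurable_funTS; exact: measurable_funM.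
have h0 s : 0 <= h s.
  by rewrite /h patchE; case: ifPn => // _; rewrite mulr_ge0.
pose F (p : measurableTypeR R * measurableTypeR R) := (h p.1 * g p.2)%:E.
have mF : measurable_fun setT F.
  apply/measurable_EFinP; apply: measurable_funM.
    by apply: measurableT_comp; [exact: mh|exact: measurable_fst].
  by apply: measurableT_comp; [exact: mg|exact: measurable_snd].
have F0 p : (0 <= F p)%E by rewrite lee_fin mulr_ge0.
transitivity (\int[leb2]_p F p)%E.
  rewrite integral_mkcond; apply: eq_integral => p _.
  rewrite patchE /F /h patchE /tens.
  have -> : (p \in open_slab T) = (p.1 \in `]0, T[%classic).
    by apply/idP/idP => /set_mem; [move=> []? _; exact/mem_set|move=> ?; exact/mem_set].
  by case: ifPn => _; rewrite ?mulrA ?mul0r.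
rewrite /leb2 (fubini_tonelli1 F mF F0) /fubini_F.
transitivity (\int[mu1]_s ((h s)%:E * \int[mu1]_y (g y)%:E))%E.
  apply: eq_integral => s _; rewrite /F /=.
  under eq_integral do rewrite EFinM.
  by rewrite ge0_integralZl_EFin//; [by move=> y _; rewrite lee_fin|exact/measurable_EFinP].
rewrite ge0_integralZr//; last 3 first.
- exact/measurable_EFinP.
- by move=> s _; rewrite lee_fin.
- by apply: integral_ge0 => y _; rewrite lee_fin.
congr (_ * _)%E; rewrite [RHS]integral_mkcond; apply: eq_integral => s _.
by rewrite /h !patchE; case: ifPn.
Qed.

Section Bounds.
Variables (T : R) (a f g : R -> R).
Hypothesis ma : measurable_fun (setT : set (measurableTypeR R)) a.
Hypotheses (cf : continuous f) (cg : continuous g).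
Hypotheses (a0 : forall s, 0 <= a s) (f0 : forall s, 0 <= f s).
Hypotheses (g0 : forall y, 0 <= g y) (g1 : (\int[mu1]_y (g y)%:E = 1)%E).
Hypothesis iaf : mu1.-integrable `]0, T[ (EFin \o (fun s => a s * f s)).

Lemma integrable_tens :
  leb2.-integrable (open_slab T) (EFin \o (fun p => a p.1 * tens f g p)).
Proof.
apply/integrableP; split.
  apply/measurable_EFinP; apply: measurable_funM; last exact: measurable_tens.
  apply: measurable_funTS; apply: measurableT_comp; [exact: ma|exact: measurable_fst].
have E : (\int[leb2]_(p in open_slab T)
    `|(EFin \o (fun p : R * R => (a p.1 * tens f g p)%R)) p| =
    \int[leb2]_(p in open_slab T) (a p.1 * tens f g p)%:E)%E.
  by apply: eq_integral => p _; rewrite /= ger0_norm// !mulr_ge0.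
rewrite [X in (X < _)%E]E.
rewrite integral_tens// g1 mule1.
by apply: integrable_lty iaf.
Qed.

Lemma Rintegral_tens :
  \int[leb2]_(p in open_slab T) (a p.1 * tens f g p) =
  \int[mu1]_(s in `]0, T[) (a s * f s).
Proof. by rewrite /Rintegral integral_tens// g1 mule1. Qed.

(** The majorant depends on time only and [g] has mass one, so its double integral collapses to an
    integral in time. *)
Lemma le_Rintegral_tens w C :
  leb2.-integrable (open_slab T) (EFin \o (fun p => w p * tens f g p)) ->
  {ae leb2, forall p, open_slab T p ->
    w p * tens f g p <= C * (a p.1 * tens f g p)} ->
  \int[leb2]_(p in open_slab T) (w p * tens f g p) <=
    C * \int[mu1]_(s in `]0, T[) (a s * f s).
Proof.
move=> iw wa; rewrite -Rintegral_tens -RintegralZl//; last 2 first.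
- exact: measurable_open_slab.
- exact: integrable_tens.
apply: ae_le_Rintegral => //; first exact: measurable_open_slab.
have := integrableZl (measurable_open_slab T) C integrable_tens.
by apply: eq_integrable => //; exact: measurable_open_slab.
Qed.

Lemma normr_Rintegral_tens w C :
  leb2.-integrable (open_slab T) (EFin \o (fun p => w p * tens f g p)) ->
  {ae leb2, forall p, open_slab T p ->
    `|w p| * tens f g p <= C * (a p.1 * tens f g p)} ->
  `|\int[leb2]_(p in open_slab T) (w p * tens f g p)| <=
    C * \int[mu1]_(s in `]0, T[) (a s * f s).
Proof.
move=> iw wa; apply: le_trans (le_normr_Rintegral _ iw) _.
  exact: measurable_open_slab.
have fg0 p : 0 <= tens f g p by rewrite mulr_ge0.
under eq_Rintegral do rewrite normrM (ger0_norm (fg0 _)).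
apply: le_Rintegral_tens wa.
have := integrable_norm iw; apply: eq_integrable.
  exact: measurable_open_slab.
by move=> p _; rewrite /= normrM (ger0_norm (fg0 _)).
Qed.

End Bounds.

End Convolution.

(** * Mollification *)

Section Mollification.
Context {R : realType}.
Local Notation mu1 := (@lebesgue_measure R).
Variable T : R.
Implicit Types (k l a th : R -> R) (t x c : R) (w : R * R -> R).

(** Integration runs over the slab, so for a kernel of radius [d] this is the full convolution when
    [d < t < T - d]. Derivatives of kernels may also be put in for [k] and [l]. *)
Definition moll w k l t x : R := \int[leb2]_(p in open_slab T)
  (w p * tens (fun s => k (t - s)) (fun y => l (x - y)) p).

(** Taken with the kernel this is [al]; taken with the step itself it is a primitive of [al]. *)
Definition tconv a k t : R := \int[mu1]_(s in `]0, T[) (a s * k (t - s)).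

Lemma continuous_subl k c : continuous k -> continuous (fun s => k (c - s)).
Proof. by move=> ck; exact: (@smoothn_subl _ 0 k c ck). Qed.

Lemma integrable_tconv a k M t :
  measurable_fun (setT : set (measurableTypeR R)) a ->
  mu1.-integrable `]0, T[ (EFin \o a) -> continuous k ->
  (forall r, `|k r| <= M) ->
  mu1.-integrable `]0, T[ (EFin \o (fun s => a s * k (t - s))).
Proof.
move=> ma ia ck kM.
apply: (@integrable_mul_supp _ _ _ mu1 `]0, T[ `]0, T[ a (fun s => k (t - s)) M) => //.
- exact: measurable_funTS.
- by apply: measurable_funTS; apply: continuous_measurable_fun; exact: (continuous_subl (c := t)).
Qed.

(** Meant for a smooth step: the bound does not see its scale. *)
Lemma le_tconv_total a k t : measurable_fun (setT : set (measurableTypeR R)) a ->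
  mu1.-integrable `]0, T[ (EFin \o a) -> continuous k -> (forall s, 0 <= a s) ->
  (forall r, 0 <= k r <= 1) ->
  0 <= tconv a k t <= \int[mu1]_(s in `]0, T[) a s.
Proof.
move=> ma ia ck a0 k01; apply/andP; split.
  by apply: Rintegral_ge0 => s _; rewrite mulr_ge0//; case/andP: (k01 (t - s)).
apply: le_Rintegral => //.
  apply: (@integrable_tconv a k 1) => // r.
  by have /andP[? ?] := k01 r; rewrite ger0_norm.
by move=> s _; rewrite ler_piMr//; case/andP: (k01 (t - s)).
Qed.

(** Global bounds take the place of compact support, because a smooth step equals 1 far to the
    right. *)
Lemma is_derive_tconv a k t M : measurable_fun (setT : set (measurableTypeR R)) a ->
  mu1.-integrable `]0, T[ (EFin \o a) -> smoothn 1 k ->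
  (forall r, `|k r| <= M) -> (forall r, `|derive1 k r| <= M) ->
  is_derive t 1 (tconv a k) (tconv a (derive1 k) t).
Proof.
move=> ma ia sk kM kM'.
apply: (@is_derive_Rintegral _ _ _ mu1 `]0, T[ `]0, T[ a
  (fun t s => k (t - s)) (fun t s => derive1 k (t - s)) M (t - 1) (t + 1)) => //.
- by rewrite in_itv/=; apply/andP; split; lra.
- exact: measurable_funTS.
- move=> s; apply: measurable_funTS; apply: continuous_measurable_fun.
  by apply: continuous_subl; exact: smoothn_continuous sk.
- move=> s y _ _.
  exact: (is_derive_subr (c := y) (smoothn_is_derive (s - y) sk)).
Qed.

Section Kernels.
Variables (d e : R) (k l : R -> R).
Hypotheses (kk : kernel d k) (kl : kernel e l).

Let sk n : smoothn n k. Proof. by case: kk. Qed.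
Let sl n : smoothn n l. Proof. by case: kl. Qed.
Let k0 r : 0 <= k r. Proof. by case: kk. Qed.
Let l0 r : 0 <= l r. Proof. by case: kl. Qed.
Let ksupp : supp_in (- d) d k. Proof. by case: kk. Qed.
Let lsupp : supp_in (- e) e l. Proof. by case: kl. Qed.
Let ck : continuous k. Proof. exact: (sk 0). Qed.
Let cl : continuous l. Proof. exact: (sl 0). Qed.

Variable t : R.
Hypotheses (td : d < t) (tT : t < T - d).

Lemma ktsupp : supp_in (t - d) (t + d) (fun s => k (t - s)).
Proof. by rewrite -{2}[d]opprK; exact: supp_in_subl ksupp. Qed.

Lemma lxsupp x : supp_in (x - e) (x + e) (fun s => l (x - s)).
Proof. by rewrite -{2}[e]opprK; exact: supp_in_subl lsupp. Qed.

Let td' : 0 < t - d. Proof. by rewrite subr_gt0. Qed.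
Let tT' : t + d < T. Proof. by rewrite -ltrBrDr. Qed.

Lemma integrable_moll w x : loc_integrable (open_slab T) w ->
  leb2.-integrable (open_slab T) (EFin \o (fun p => w p *
    tens (fun s => k (t - s)) (fun y => l (x - y)) p)).
Proof.
move=> lw; apply: (integrable_mul_tens lw (a := t - d) (b := t + d)
  (c := x - e) (d := x + e)) => //.
- exact: (continuous_subl (c := t) ck).
- exact: (continuous_subl (c := x) cl).
- exact: ktsupp.
- exact: lxsupp.
Qed.

Lemma tens_ge0 x p : 0 <= tens (fun s => k (t - s)) (fun y => l (x - y)) p.
Proof.
by rewrite mulr_ge0.
Qed.

Lemma lx_int x : (\int[mu1]_y (l (x - y))%:E = 1)%E.
Proof. by have [_ _ _ ->] := kl. Qed.

Lemma kt_int : (\int[mu1]_(s in `]0%R, T[) (k (t - s))%:E = 1)%E.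
Proof.
have [_ _ _ -> //] := kk.
move=> s /=; rewrite !in_itv/= => /andP[h1 h2].
by rewrite (lt_le_trans td' h1) (le_lt_trans h2 tT').
Qed.

Let ker x : R * R -> R := tens (fun s => k (t - s)) (fun y => l (x - y)).

Let one_kt : mu1.-integrable `]0, T[ (EFin \o (fun s => cst 1 s * k (t - s))).
Proof.
apply/integrableP; split.
  apply/measurable_EFinP; apply: measurable_funTS; apply: measurable_funM => //.
  by apply: continuous_measurable_fun; exact: (continuous_subl (c := t)).
rewrite (_ : (\int[mu1]_(s in `]0%R, T[) _)%E = 1%E) ?ltry//.
rewrite -[RHS]kt_int; apply: eq_integral => s _ /=.
by rewrite ger0_norm mul1r.
Qed.

Lemma integrable_Rintegral_ker x :
  leb2.-integrable (open_slab T) (EFin \o ker x) /\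
  \int[leb2]_(p in open_slab T) ker x p = 1.
Proof.
have m1 : measurable_fun (setT : set (measurableTypeR R)) (cst (1 : R)) by [].
have cx := continuous_subl (c := x) cl.
have ct := continuous_subl (c := t) ck.
have kt0 s : 0 <= k (t - s) by [].
have lx0 s : 0 <= l (x - s) by [].
have one0 (s : R) : 0 <= cst 1 s :> R by [].
have E : (fun p => cst 1 p.1 * ker x p) = ker x.
  by apply/funext => p; rewrite mul1r.
split.
  have := integrable_tens m1 ct cx one0 kt0 lx0 (lx_int x) one_kt.
  by rewrite E.
have := Rintegral_tens T m1 ct cx one0 kt0 lx0 (lx_int x).
rewrite E => ->.
rewrite /Rintegral (_ : (\int[mu1]_(s in `]0%R, T[) _)%E = 1%E)//.
by rewrite -[RHS]kt_int; apply: eq_integral => s _; rewrite mul1r.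
Qed.

Lemma kerN0 x p : ker x p != 0 -> box (t - d) (t + d) (x - e) (x + e) p.
Proof.
by move=> /eqP h; apply: contrapT => /(tens_supp ktsupp (lxsupp (x := x))).
Qed.

Let mD : measurable (open_slab T : set (measurableTypeR R * measurableTypeR R)).
Proof. exact: measurable_open_slab. Qed.

(** The kernel is a probability density on the slab that vanishes off the box, so averages obey
    bounds known on the box alone. *)
Lemma le_moll w x c : loc_integrable (open_slab T) w ->
  (forall p, box (t - d) (t + d) (x - e) (x + e) p -> w p <= c) ->
  moll w k l t x <= c.
Proof.
move=> lw wc; have [iker Iker] := integrable_Rintegral_ker x.
rewrite -[leRHS]mulr1 -Iker -RintegralZl//; apply: le_Rintegral => //.
- exact: integrable_moll.
- have := integrableZl mD c iker.
  by apply: eq_integrable.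
move=> p _; change (w p * ker x p <= c * ker x p).
have [->|/kerN0/wc h] := eqVneq (ker x p) 0; first by rewrite !mulr0.
by rewrite ler_wpM2r// tens_ge0.
Qed.

Lemma ge_moll w x c : loc_integrable (open_slab T) w ->
  (forall p, box (t - d) (t + d) (x - e) (x + e) p -> c <= w p) ->
  c <= moll w k l t x.
Proof.
move=> lw wc; have [iker Iker] := integrable_Rintegral_ker x.
rewrite -[leLHS]mulr1 -Iker -RintegralZl//; apply: le_Rintegral => //.
- have := integrableZl mD c iker.
  by apply: eq_integrable.
- exact: integrable_moll.
move=> p _; change (c * ker x p <= w p * ker x p).
have [->|/kerN0/wc h] := eqVneq (ker x p) 0; first by rewrite !mulr0.
by rewrite ler_wpM2r// tens_ge0.
Qed.

Lemma is_derive_moll_t w wt x : weak_derivative (open_slab T) 1 0 w wt ->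
  is_derive t 1 (fun s => moll w k l s x) (moll wt k l t x).
Proof.
move=> wd; have lw : loc_integrable (open_slab T) w by case: wd.
have tT2 : t - - d < T by rewrite opprK.
rewrite /moll -(weak_dt_conv x wd td' tT2 sk sl ksupp lsupp).
exact: (is_derive_conv_t lw (sk 1) (continuous_subl (c := x) cl) ksupp
  (lxsupp (x := x)) td' tT2).
Qed.

Lemma is_derive_moll_x w x : loc_integrable (open_slab T) w ->
  is_derive x 1 (moll w k l t) (moll w k (derive1 l) t x).
Proof.
move=> lw; exact: (is_derive_conv_x x lw (continuous_subl (c := t) ck)
  (sl 1) ktsupp lsupp td' tT').
Qed.

Lemma is_derive_moll_xx w wxx x : weak_derivative (open_slab T) 0 2 w wxx ->
  is_derive x 1 (moll w k (derive1 l) t) (moll wxx k l t x).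
Proof.
move=> wd; have lw : loc_integrable (open_slab T) w by case: wd.
have tT2 : t - - d < T by rewrite opprK.
rewrite /moll -(weak_dxx_conv x wd td' tT2 sk sl ksupp lsupp).
exact: (is_derive_conv_x x lw (continuous_subl (c := t) ck)
  (smoothn_derive1 (sl 2)) ktsupp (supp_in_derive1 lsupp) td' tT').
Qed.

Section Weighted.
Variable a : R -> R.
Hypothesis ma : measurable_fun (setT : set (measurableTypeR R)) a.
Hypothesis a0 : forall s, 0 <= a s.
Hypothesis ia : mu1.-integrable `]0, T[ (EFin \o a).

Let iak : mu1.-integrable `]0, T[ (EFin \o (fun s => a s * k (t - s))).
Proof.
have [M _ kM] := supp_in_bounded ck ksupp.
exact: (@integrable_tconv a k M).
Qed.

Lemma normr_moll w x C : loc_integrable (open_slab T) w ->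
  {ae leb2, forall p, open_slab T p ->
    `|w p| * ker x p <= C * (a p.1 * ker x p)} ->
  `|moll w k l t x| <= C * tconv a k t.
Proof.
move=> lw wa; apply: normr_Rintegral_tens => //.
- exact: (continuous_subl (c := t) ck).
- exact: (continuous_subl (c := x) cl).
- exact: lx_int.
- exact: integrable_moll.
Qed.

(* Freezing the coefficient [u] at the value [c] makes the product commute with
   mollification up to [eta] times the bound on [h]. *)
Lemma le_moll_mul u h w x c eta : 0 <= eta ->
  loc_integrable (open_slab T) w -> loc_integrable (open_slab T) h ->
  (forall p, box (t - d) (t + d) (x - e) (x + e) p -> `|u p - c| <= eta) ->
  {ae leb2, forall p, open_slab T p -> `|h p| <= a p.1} ->
  {ae leb2, forall p, open_slab T p -> w p <= 2^-1 * u p * h p} ->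
  moll w k l t x <= 2^-1 * c * moll h k l t x + 2^-1 * eta * tconv a k t.
Proof.
move=> eta0 lw lh uc ha wuh; rewrite -lerBlDl.
have iw := integrable_moll x lw; have ih := integrable_moll x lh.
have ich : leb2.-integrable (open_slab T)
    (EFin \o (fun p => 2^-1 * c * (h p * ker x p))).
  by have := integrableZl mD (2^-1 * c) ih; exact: eq_integrable.
rewrite -RintegralZl// -RintegralB//.
have -> : \int[leb2]_(p in open_slab T) (w p * ker x p - 2^-1 * c * (h p * ker x p)) =
    \int[leb2]_(p in open_slab T) ((w p - 2^-1 * c * h p) * ker x p).
  by apply: eq_Rintegral => p _; ring.
apply: (@le_Rintegral_tens _ T a (fun s => k (t - s)) (fun y => l (x - y))) => //.
- exact: (continuous_subl (c := t) ck).
- exact: (continuous_subl (c := x) cl).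
- exact: lx_int.
- have := integrableB mD iw ich; apply: eq_integrable => // p _ /=.
  by rewrite -EFinB; congr EFin; rewrite -/(ker x); ring.
move: ha wuh; apply: (@filterS2 _ _ (ae_filter_ringOfSetsType leb2)) => p ha wuh pT.
rewrite -/(ker x).
have [->|/kerN0/uc h1] := eqVneq (ker x p) 0; first by rewrite !mulr0.
rewrite [leRHS]mulrA ler_wpM2r ?tens_ge0//.
(* Here [w - c h / 2 <= (u - c) h / 2], and on the box the right side is at most [eta a / 2]. *)
apply: (@le_trans _ _ (2^-1 * (`|u p - c| * `|h p|))).
  have := wuh pT; have := ler_norm ((u p - c) * h p); rewrite normrM; nra.
by rewrite -mulrA ler_pM2l// ler_pM// ha.
Qed.

End Weighted.

End Kernels.
End Mollification.

(** * Quadratic growth *)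

Section SlabContinuity.
Context {R : realType}.
Local Notation mu1 := (@lebesgue_measure R).
Implicit Types (T t x r : R) (u w : R * R -> R).

(** Only [p] is confined to a compact box; [q] may leave it, which is handy for points in a kernel's
    support. Near each [p0] take half the continuity radius for [p] and half for the distance from
    [p] to [q], then use compactness. *)
Lemma unif_continuous_slab T u r eps : {within slab T, continuous u} -> 0 < eps ->
  exists2 dl, 0 < dl & forall p q, slab T p -> slab T q -> `|p.2| <= r ->
    `|p.1 - q.1| < dl -> `|p.2 - q.2| < dl -> `|u p - u q| < eps.
Proof.
move=> cu eps0.
have cK : compact (box 0 T (- r) r) by exact: compact_box.
move/compact_near_coveringP : cK => cK.
pose P (dl : R) (p : R * R) := slab T p -> forall q, slab T q ->
    `|p.1 - q.1| < dl -> `|p.2 - q.2| < dl -> `|u p - u q| < eps.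
have : \forall dl \near 0^'+, box 0 T (- r) r `<=` P dl.
  apply: cK => p0 [p01 p02].
  have sp0 : slab T p0 by split.
  have /subspace_continuousP/(_ _ sp0) cup := cu.
  have e2 : 0 < eps / 2 by rewrite divr_gt0.
  move/cvgrPdist_lt : cup => /(_ _ e2).
  rewrite near_withinE => /nbhs_ballP[rho /= rho0 hrho].
  near=> p dl.
  move=> sp q sq q1 q2.
  have dlrho : dl < rho / 2.
    by near: dl; apply: nbhs_right_lt; exact: divr_gt0.
  have [p1 p2] : ball p0 (rho / 2) p.
    by near: p; apply: nbhsx_ballx; exact: divr_gt0.
  have up : `|u p0 - u p| < eps / 2.
    have hr : rho / 2 <= rho by rewrite ler_pdivrMr// ler_peMr ?ler1n// ltW.
    by apply: hrho => //; split; [exact: le_ball hr _ p1|exact: le_ball hr _ p2].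
  have uq : `|u p0 - u q| < eps / 2.
    apply: hrho => //; split; rewrite /ball/= [rho]splitr.
      by rewrite (le_lt_trans (ler_distD p.1 p0.1 q.1))// ltrD// (lt_trans q1).
    by rewrite (le_lt_trans (ler_distD p.2 p0.2 q.2))// ltrD// (lt_trans q2).
  rewrite [eps]splitr (le_lt_trans (ler_distD (u p0) _ _))// ltrD//.
  by rewrite distrC.
move=> near0.
have : \forall dl \near 0^'+, 0 < dl /\ box 0 T (- r) r `<=` P dl.
  by apply: filterI near0; exact: nbhs_right_gt.
move=> /filter_ex [dl [dl0 hP]].
exists dl => // p q sp sq pr; apply: hP => //.
by case: sp => sp _; split => //=; rewrite in_itv/= -ler_norml.
Unshelve. all: by end_near. Qed.

Lemma bounded_slab T u r : {within slab T, continuous u} ->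
  exists N, forall p, slab T p -> `|p.2| <= r -> `|u p| <= N.
Proof.
move=> cu.
have cK : compact (u @` box 0 T (- r) r).
  apply: continuous_compact; last exact: compact_box.
  by apply: continuous_subspaceW cu => p [? _]; split.
have [M [_ hM]] := compact_bounded cK.
exists (`|M| + 1) => p [sp _] pr; apply: hM.
  by rewrite (le_lt_trans (ler_norm M))// ltrDl.
by exists p => //; split => //=; rewrite in_itv/= -ler_norml.
Qed.

Lemma mvt_itv (f f1 : R -> R) (x y : R) :
  (forall z, Num.min x y <= z <= Num.max x y -> is_derive z 1 f (f1 z)) ->
  exists2 c, Num.min x y <= c <= Num.max x y & f y - f x = f1 c * (y - x).
Proof.
have main (a b : R) : a <= b -> (forall z, a <= z <= b -> is_derive z 1 f (f1 z)) ->
    exists2 c, a <= c <= b & f b - f a = f1 c * (b - a).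
  move=> ab df; have [||c cab ->] := @MVT_segment _ f f1 a b ab.
  - by move=> z; rewrite in_itv/= => /andP[? ?]; apply: df; rewrite !ltW.
  - apply: derivable_within_continuous => z; rewrite in_itv/= => /df.
    by case.
  by exists c => //; move: cab; rewrite in_itv.
have [xy|/ltW xy] := leP x y; first exact: main.
move=> /(main _ _ xy)[c cyx E]; exists c => //.
by rewrite -opprB E; ring.
Qed.

Lemma mvt (f f1 : R -> R) (x y : R) : (forall z : R, is_derive z 1 f (f1 z)) ->
  exists2 c, Num.min x y <= c <= Num.max x y & f y - f x = f1 c * (y - x).
Proof. by move=> df; apply: mvt_itv. Qed.

(** The values at 0 and 1 bound the derivative by [2 N] somewhere in [[0, 1]]. The bound on [f2]
    makes it grow at most linearly from there, and a second application of the mean value theorem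
    gives the quadratic. *)
Lemma quadratic_bound (f f1 f2 : R -> R) (M N x : R) :
  (forall z : R, is_derive z 1 f (f1 z)) -> (forall z : R, is_derive z 1 f1 (f2 z)) ->
  (forall z : R, `|f2 z| <= M) -> `|f 0| <= N -> `|f 1| <= N ->
  `|f x| <= (2 * N + 2 * M) * (1 + x ^+ 2).
Proof.
move=> df df1 f2M f0N f1N.
have M0 : 0 <= M by exact: le_trans (f2M 0).
have N0 : 0 <= N by exact: le_trans f0N.
have [c] := mvt 0 1 df; rewrite subr0 mulr1.
rewrite (min_l ler01) (max_r ler01) => /andP[c0 c1] Ec.
have f1c : `|f1 c| <= 2 * N.
  by rewrite -Ec (le_trans (ler_normB _ _))//; lra.
have f1y y : `|f1 y| <= 2 * N + M * (`|y| + 1).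
  have [c' _ Ec'] := mvt c y df1.
  have -> : f1 y = f1 c + f2 c' * (y - c) by rewrite -Ec' addrC subrK.
  rewrite (le_trans (ler_normD _ _))// lerD// normrM ler_pM//.
  by rewrite (le_trans (ler_normB _ _))// lerD// ger0_norm.
have [b] := mvt 0 x df; rewrite subr0 => bx Eb.
have b_le : `|b| <= `|x|.
  move: bx; have [x0|x0] := leP 0 x => /andP[b1 b2].
    by rewrite !ger0_norm.
  by rewrite (ltr0_norm x0) (ler0_norm b2) lerN2.
have -> : f x = f 0 + f1 b * x by rewrite -Eb addrC subrK.
have x2 : `|x| ^+ 2 = x ^+ 2 by rewrite real_normK// num_real.
have h : `|f1 b * x| <= (2 * N + M * (`|x| + 1)) * `|x|.
  rewrite normrM ler_wpM2r// (le_trans (f1y b))// lerD2l ler_wpM2l// lerD2r.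
  exact: b_le.
rewrite (le_trans (ler_normD _ _))//.
have := sqr_ge0 (`|x| - 1).
have := normr_ge0 x; move: h f0N; rewrite -x2.
move: (`|f1 b * x|) (`|f 0|) (`|x|) => A B X hA hB X0 sq.
nra.
Qed.

End SlabContinuity.

(** * Oscillation in time *)

Section TimeRegularity.
Context {R : realType}.
Local Notation mu1 := (@lebesgue_measure R).
Implicit Types (T t x : R) (u : R * R -> R).

(** From [y^2 <= 2 x^2 + 2 (y - x)^2]. It transfers quadratic weights across a kernel of radius at
    most 1, at the price of a factor 3. *)
Lemma sqr_near1 (x y : R) : `|y - x| <= 1 -> 1 + y ^+ 2 <= 3 * (1 + x ^+ 2).
Proof.
rewrite ler_norml => /andP[h1 h2].
have z1 : 0 <= (1 - (y - x)) * (1 + (y - x)) by rewrite mulr_ge0//; lra.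
have := sqr_ge0 (2 * x - y); have := sqr_ge0 x; nra.
Qed.

Lemma dist_close (a b A B C eps : R) : `|A - a| <= eps / 2 ->
  `|B - b| <= eps / 2 -> `|A - B| <= C -> `|a - b| <= C + eps.
Proof.
rewrite !ler_norml => /andP[h1 h2] /andP[h3 h4] /andP[h5 h6].
by apply/andP; split; lra.
Qed.

Section TimeLipschitz.
Variables (T : R) (u ut : R * R -> R) (b : R -> R).
Hypothesis wdt : weak_derivative (open_slab T) 1 0 u ut.
Hypothesis mb : measurable_fun (setT : set (measurableTypeR R)) b.
Hypothesis b0 : forall s, 0 <= b s.
Hypothesis ib : mu1.-integrable `]0, T[ (EFin \o b).
Hypothesis utb : {ae leb2, forall p, open_slab T p ->
  `|ut p| <= (1 + p.2 ^+ 2) * b p.1}.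

(** The weak time derivative is tested against [f s = th (t - s) - th (t' - s)] times the space
    kernel; since [f] lies between 0 and 1, only the integral of [b] is left. *)
Lemma moll_time_lipschitz d e th l t t' x :
  smooth_step d th -> kernel e l -> e <= 1 -> d < t' -> t' <= t -> t < T - d ->
  0 < d ->
  `|moll T u (derive1 th) l t x - moll T u (derive1 th) l t' x| <=
  3 * (1 + x ^+ 2) * \int[mu1]_(s in `]0, T[) b s.
Proof.
move=> sth kl e1 dt' t't tT d0.
have [sl lsupp l0 lint] := kl.
have lu : loc_integrable (open_slab T) u by case: wdt.
have lut : loc_integrable (open_slab T) ut by case: wdt.
have kth := step_kernel d0 sth.
pose f s := th (t - s) - th (t' - s).
have sf j : smoothn j f.
  have := smoothnD (smoothn_subl t (step_smooth sth j))
    (smoothnM (smoothn_cst j (-1)) (smoothn_subl t' (step_smooth sth j))).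
  by congr smoothn; apply/funext => s; rewrite /f mulN1r.
have df : derive1 f = fun s => derive1 th (t' - s) - derive1 th (t - s).
  apply/funext => s; apply: derive1_is_derive.
  have h c : is_derive s 1 (fun s => th (c - s)) (- derive1 th (c - s)).
    by apply: is_derive_subl; exact: step_is_derive sth _.
  apply: (is_derive_eq (is_deriveB (h t) (h t'))).
  by rewrite opprK addrC.
(* Left of the interval both steps are 1, right of it both are 0, so [f] is compactly supported
   although [th] is not. *)
have fsupp : supp_in (t' - d) (t + d) f.
  move=> s; rewrite negb_and -!ltNge /f; have [_ th0 th1 _] := sth.
  case/orP => h.
    by rewrite (th1 (t - s)) ?(th1 (t' - s)) ?subrr//; lra.
  by rewrite (th0 (t - s)) ?(th0 (t' - s)) ?subrr//; lra.
have f01 s : 0 <= f s <= 1.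
  have := step_itv sth (t - s); have := step_itv sth (t' - s).
  have : th (t' - s) <= th (t - s) by apply: (step_le sth); lra.
  by rewrite /f => h /andP[h1 h2] /andP[h3 h4]; apply/andP; split; lra.
have cf : continuous f by exact: (sf 0%N).
pose g y := l (x - y).
have sg j : smoothn j g by exact: smoothn_subl (sl j).
have gsupp : supp_in (x - e) (x + e) g by exact: lxsupp kl x.
have ad : 0 < t' - d by rewrite subr_gt0.
have bd : t + d < T by rewrite -ltrBrDr.
have := weak_dt_tens wdt ad bd sf sg fsupp gsupp; rewrite df => W.
have -> : moll T u (derive1 th) l t x - moll T u (derive1 th) l t' x =
    \int[leb2]_(p in open_slab T) (ut p * tens f g p).
  apply/oppr_inj; rewrite -W opprB /moll -RintegralB.
  - by apply: eq_Rintegral => p _; rewrite /tens -/(g _) /=; ring.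
  - exact: measurable_open_slab.
  - by apply: (integrable_moll kth kl) => //; lra.
  - by apply: (integrable_moll kth kl) => //; lra.
have cg : continuous g by exact: (sg 0%N).
have ibf : mu1.-integrable `]0, T[ (EFin \o (fun s => b s * f s)).
  apply: (@integrable_mul_supp _ _ _ mu1 `]0, T[ `]0, T[ b f 1) => //.
  - exact: measurable_funTS.
  - by apply: measurable_funTS; exact: continuous_measurable_fun.
  - by move=> s _; have /andP[h1 h2] := f01 s; rewrite ger0_norm.
apply: (@le_trans _ _ (3 * (1 + x ^+ 2) * \int[mu1]_(s in `]0, T[) (b s * f s))).
  apply: normr_Rintegral_tens => //.
  - by move=> s; case/andP: (f01 s).
  - by move=> y; exact: l0.
  - by apply: lint => //; exact: measurableT.
  - exact: integrable_mul_tens lut ad bd cf cg fsupp gsupp.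
  apply: (@filterS _ _ (ae_filter_ringOfSetsType leb2)) utb => p utp pT.
  have tp0 : 0 <= tens f g p.
    by apply: mulr_ge0; [case/andP: (f01 p.1)|exact: l0].
  have [->|] := eqVneq (tens f g p) 0; first by rewrite !mulr0.
  move=> /eqP tn; have [_ pbox] : box (t' - d) (t + d) (x - e) (x + e) p.
    by apply: contrapT => /(tens_supp fsupp gsupp).
  rewrite mulrA ler_wpM2r// (le_trans (utp pT))// ler_wpM2r// sqr_near1//.
  move: pbox; rewrite /= in_itv/= => /andP[h1 h2].
  by rewrite ler_norml; apply/andP; split; lra.
rewrite ler_wpM2l//; first by rewrite mulr_ge0// addr_ge0// sqr_ge0.
apply: le_Rintegral => // s _.
by rewrite ler_piMr//; case/andP: (f01 s).
Qed.

Hypothesis cu : {within slab T, continuous u}.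

Lemma moll_close d e k l t x eta : kernel d k -> kernel e l ->
  d < t -> t < T - d ->
  (forall p, slab T p -> `|t - p.1| <= d -> `|x - p.2| <= e ->
    `|u (t, x) - u p| <= eta) -> `|moll T u k l t x - u (t, x)| <= eta.
Proof.
move=> kk kl dt tT h.
have lu : loc_integrable (open_slab T) u by case: wdt.
have hb p : box (t - d) (t + d) (x - e) (x + e) p -> `|u (t, x) - u p| <= eta.
  move=> [/= p1 p2]; move: p1 p2; rewrite !in_itv/= => /andP[h1 h2] /andP[h3 h4].
  apply: h; last 2 first.
  - by rewrite ler_norml; apply/andP; split; lra.
  - by rewrite ler_norml; apply/andP; split; lra.
  by split => //=; rewrite in_itv/=; apply/andP; split; lra.
rewrite ler_norml; apply/andP; split.
  rewrite lerBrDr; apply: (ge_moll kk kl dt tT lu) => p /hb.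
  by rewrite ler_norml => /andP[h1 h2]; lra.
rewrite lerBlDr; apply: (le_moll kk kl dt tT lu) => p /hb.
by rewrite ler_norml => /andP[h1 h2]; lra.
Qed.

(** There is no factor [t - t']: an oscillation bound is enough. Mollification moves each value by
    at most [eps / 2], while the bound for the mollified values does not depend on the scale. *)
Lemma time_lipschitz t t' x : 0 < t < T -> 0 < t' < T ->
  `|u (t, x) - u (t', x)| <= 3 * (1 + x ^+ 2) * \int[mu1]_(s in `]0, T[) b s.
Proof.
wlog t't : t t' / t' <= t.
  move=> H ht ht'; have [|/ltW] := leP t' t; first by move=> ?; exact: H.
  by move=> ?; rewrite distrC; exact: H.
move=> /andP[t0 tT] /andP[t'0 t'T].
apply/ler_addgt0Pr => eps eps0.
have e2 : 0 < eps / 2 by exact: divr_gt0.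
have [dl dl0 hdl] := unif_continuous_slab `|x| cu e2.
pose d := Num.min 1 (Num.min (dl / 2) (Num.min (t' / 2) ((T - t) / 2))).
have d0 : 0 < d by rewrite !lt_min ltr01 !divr_gt0// subr_gt0.
have d1 : d <= 1 by rewrite ge_min lexx.
have d_dl : d < dl.
  by rewrite (@le_lt_trans _ _ (dl / 2)) ?ge_min ?lexx ?orbT//; lra.
have dt' : d < t'.
  by rewrite (@le_lt_trans _ _ (t' / 2)) ?ge_min ?lexx ?orbT//; lra.
have dT : t < T - d.
  rewrite ltrBrDl -ltrBrDr.
  by rewrite (@le_lt_trans _ _ ((T - t) / 2)) ?ge_min ?lexx ?orbT//; lra.
have [th sth] := smooth_step_ex d0.
have kth := step_kernel d0 sth.
have close s : d < s -> s < T - d ->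
    `|moll T u (derive1 th) (derive1 th) s x - u (s, x)| <= eps / 2.
  move=> ds sT; apply: (moll_close kth kth ds sT) => p sp p1 p2; apply/ltW.
  apply: hdl => //=; try exact: le_lt_trans d_dl.
  by split => //=; rewrite in_itv/=; apply/andP; split; lra.
have := moll_time_lipschitz x sth kth d1 dt' t't dT d0; move: (3 * _ * _) => C.
move=> UV; apply: dist_close UV; first exact: close (lt_le_trans dt' t't) dT.
exact: close dt' (le_lt_trans t't dT).
Qed.

End TimeLipschitz.
End TimeRegularity.

Section QuadraticGrowth.
Context {R : realType}.
Local Notation mu1 := (@lebesgue_measure R).

(** As [uxx] is only L^1 in time, single slices of [u] have no bounded second derivative, but an
    average over a fixed time window does. The window has centre [T / 2] and radius [T / 3]. The
    space scale [e] may depend on [x], since [N] and [M] do not depend on [e]. *)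
Lemma quadratic_growth (T : R) (u ut uxx : R * R -> R) (a b : R -> R) :
  0 < T -> {within slab T, continuous u} ->
  weak_derivative (open_slab T) 1 0 u ut ->
  weak_derivative (open_slab T) 0 2 u uxx ->
  measurable_fun (setT : set (measurableTypeR R)) a -> (forall s, 0 <= a s) ->
  mu1.-integrable `]0, T[ (EFin \o a) ->
  {ae leb2, forall p : R * R, open_slab T p -> `|uxx p| <= a p.1} ->
  measurable_fun (setT : set (measurableTypeR R)) b -> (forall s, 0 <= b s) ->
  mu1.-integrable `]0, T[ (EFin \o b) ->
  {ae leb2, forall p : R * R, open_slab T p -> `|ut p| <= (1 + p.2 ^+ 2) * b p.1} ->
  exists2 C, 0 <= C & forall p, open_slab T p -> u p <= C * (1 + p.2 ^+ 2).
Proof.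
move=> T0 cu wdt wdxx ma a0 ia uxxa mb b0 ib utb.
have lu : loc_integrable (open_slab T) u by case: wdt.
have luxx : loc_integrable (open_slab T) uxx by case: wdxx.
have T3 : 0 < T / 3 by rewrite divr_gt0.
have [th sth] := smooth_step_ex T3.
have kth := step_kernel T3 sth; set k := derive1 th in kth.
(* Radius 2 covers [|y| <= 1] enlarged by the space scale [e <= 1]. *)
have [N hN] := bounded_slab 2 cu.
have N0 : 0 <= N.
  have s0 : slab T (0, 0) by split => //=; rewrite in_itv/= lexx ltW.
  by apply: le_trans (hN _ s0 _) => //=; rewrite normr0.
have h1 : T / 3 < T / 2 by lra.
have h2 : T / 2 < T - T / 3 by lra.
pose M := tconv T a k (T / 2).
have M0 : 0 <= M.
  by apply: Rintegral_ge0 => s _; rewrite mulr_ge0//; case: kth.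
pose B := \int[mu1]_(s in `]0, T[) b s.
have B0 : 0 <= B by apply: Rintegral_ge0 => s _.
(* The 1 pays for moving in space, [9 = 3 * 3] for moving in time at a nearby [y] and returning to
   the weight at [x]; the rest is [quadratic_bound]. *)
exists (1 + 9 * B + (2 * N + 2 * M)).
  by rewrite !addr_ge0// mulr_ge0.
move=> [t x] [/= + _]; rewrite in_itv/= => /andP[t0 tT].
have [dl dl0 hdl] := unif_continuous_slab `|x| cu ltr01.
pose e := Num.min 1 (dl / 2).
have e0 : 0 < e by rewrite lt_min ltr01 divr_gt0.
have e1 : e <= 1 by rewrite ge_min lexx.
have e_dl : e < dl by rewrite (@le_lt_trans _ _ (dl / 2)) ?ge_min ?lexx ?orbT//; lra.
have [ze sze] := smooth_step_ex e0.
have kze := step_kernel e0 sze; set l := derive1 ze in kze.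
have tb p y : box (T / 2 - T / 3) (T / 2 + T / 3) (y - e) (y + e) p ->
    0 < p.1 < T /\ `|p.2 - y| <= e.
  move=> [/=]; rewrite !in_itv/= => /andP[p1 p2] /andP[p3 p4].
  clear - T0 p1 p2 p3 p4; split; first by apply/andP; split; lra.
  by rewrite ler_norml; apply/andP; split; lra.
have vN y : `|y| <= 1 -> `|moll T u k l (T / 2) y| <= N.
  move=> y1; have uN p : box (T / 2 - T / 3) (T / 2 + T / 3) (y - e) (y + e) p ->
      `|u p| <= N.
    move=> /tb[/andP[p0 pT] py]; apply: hN.
      by split => //=; rewrite in_itv/= !ltW.
    by rewrite -[p.2](subrK y) (le_trans (ler_normD _ _))//; lra.
  rewrite ler_norml; apply/andP; split.
    by apply: (ge_moll kth kze h1 h2 lu) => p /uN; rewrite ler_norml => /andP[].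
  by apply: (le_moll kth kze h1 h2 lu) => p /uN; rewrite ler_norml => /andP[].
have vxx y : `|moll T uxx k l (T / 2) y| <= M.
  rewrite -[M]mul1r; apply: (normr_moll kth kze h1 h2 ma a0 ia luxx).
  apply: (@filterS _ _ (ae_filter_ringOfSetsType leb2)) uxxa => p uxxp pT.
  by rewrite mul1r ler_wpM2r ?(tens_ge0 kth kze)// uxxp.
have vx : `|moll T u k l (T / 2) x| <= (2 * N + 2 * M) * (1 + x ^+ 2).
  apply: (@quadratic_bound _ _ (moll T u k (derive1 l) (T / 2))
    (moll T uxx k l (T / 2))) => //.
  - by move=> z; exact: (is_derive_moll_x kth kze h1 h2).
  - by move=> z; exact: (is_derive_moll_xx kth kze h1 h2).
  - by apply: vN; rewrite normr0.
  - by apply: vN; rewrite normr1.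
(* The left side is below [u (s, y)] on the whole box, hence below the average. *)
have lower : u (t, x) - 1 - 9 * (1 + x ^+ 2) * B <= moll T u k l (T / 2) x.
  apply: (ge_moll kth kze h1 h2 lu) => -[s y] /tb[/= s0T yx].
  have tT0 : 0 < t < T by rewrite t0.
  have := time_lipschitz wdt mb b0 ib utb cu y tT0 s0T.
  rewrite ler_norml -/B => /andP[_ lip].
  have : `|u (t, x) - u (t, y)| < 1.
    apply: hdl => //=.
    - by split => //=; rewrite in_itv/= !ltW.
    - by split => //=; rewrite in_itv/= !ltW.
    - by rewrite subrr normr0.
    - by rewrite distrC (le_lt_trans yx).
  rewrite ltr_norml => /andP[_ close].
  have yx1 := sqr_near1 (le_trans yx e1).
  have : (1 + y ^+ 2) * B <= 3 * (1 + x ^+ 2) * B by rewrite ler_wpM2r.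
  by move: lip close; lra.
move: vx; rewrite ler_norml => /andP[_ vx].
have := sqr_ge0 x; lra.
Qed.

End QuadraticGrowth.

(** * Maximum principle *)

Section MaximumPrinciple.
Context {R : realType}.
Implicit Types (f g : R -> R) (a b t x : R).

Lemma is_derive_gt0_near f x (l : R) : is_derive x 1 f l -> 0 < l ->
  exists2 e, 0 < e & forall h, 0 < h < e -> f x < f (x + h) /\ f (x - h) < f x.
Proof.
move=> fl l0; have fd : derivable f x 1 by case: fl.
have : h^-1 * (f (h + x) - f x) @[h --> 0^'] --> l.
  have <- : 'D_1 f x = l by exact: derive_val.
  move: fd; rewrite /derivable /derive /=.
  by under eq_fun do rewrite /GRing.scale/= mulr1.
move=> /cvgr_gt/(_ _ l0); rewrite near_withinE => /nbhs_ballP[e /= e0 he].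
exists e => // h /andP[h0 hlt].
have hb (y : R) : `|y| = h -> 0 < y^-1 * (f (y + x) - f x).
  move=> yh; apply: he; first by rewrite /ball/= sub0r normrN yh.
  by rewrite -normr_gt0 yh.
split.
  have /hb : `|h| = h by rewrite gtr0_norm.
  by rewrite pmulr_rgt0 ?invr_gt0// subr_gt0 addrC.
have /hb : `|- h| = h by rewrite normrN gtr0_norm.
by rewrite nmulr_rgt0 ?invr_lt0 ?oppr_lt0// subr_lt0 addrC.
Qed.

(** Only values to the left of [x] are compared, so the lemma applies at a final time. *)
Lemma derive_left_max f a x l : a < x -> is_derive x 1 f l ->
  (forall y, a <= y <= x -> f y <= f x) -> 0 <= l.
Proof.
move=> ax fl fmax; rewrite leNgt; apply/negP => l0.
have /is_derive_gt0_near : is_derive x 1 (fun y => - f y) (- l).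
  exact: is_deriveN.
rewrite oppr_gt0 => /(_ l0)[e e0 he].
pose h := Num.min (e / 2) (x - a).
have h0 : 0 < h by rewrite lt_min divr_gt0// subr_gt0.
have [|_] := he h; rewrite ?h0/=.
  by rewrite (@le_lt_trans _ _ (e / 2)) ?ge_min ?lexx//; lra.
rewrite ltrN2; apply/negP; rewrite -leNgt; apply: fmax.
by rewrite lerBrDl -lerBrDr ge_min lexx orbT/= gerBl ltW.
Qed.

(** At the maximum [f1] vanishes; if [l] were positive, [f1] would be positive just to the right and
    [f] would increase there. *)
Lemma derive2_max f (f1 : R -> R) a b x l : a < x < b ->
  (forall y, a < y < b -> is_derive y 1 f (f1 y)) -> is_derive x 1 f1 l ->
  (forall y, a < y < b -> f y <= f x) -> l <= 0.
Proof.
move=> axb df df1 fmax; have /andP[ax xb] := axb.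
have f1x : f1 x = 0.
  have <- : derive1 f x = f1 x by apply: derive1_is_derive; exact: df.
  apply: derive1_is_derive; apply: (@derive1_at_max _ f a b).
  - by rewrite ltW// (lt_trans ax).
  - by move=> y; rewrite in_itv/= => /df[].
  - by rewrite in_itv.
  - by move=> y; rewrite in_itv; exact: fmax.
rewrite leNgt; apply/negP => l0.
have [e e0 he] := is_derive_gt0_near df1 l0.
pose h := Num.min (e / 2) ((b - x) / 2).
have h0 : 0 < h by rewrite lt_min !divr_gt0// subr_gt0.
have he2 : h < e by rewrite (@le_lt_trans _ _ (e / 2)) ?ge_min ?lexx//; lra.
have hb : x + h < b.
  by rewrite -ltrBrDl (@le_lt_trans _ _ ((b - x) / 2)) ?ge_min ?lexx ?orbT//; lra.
have xh : x < x + h by rewrite ltrDl.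
have [||c] := @MVT _ f f1 x (x + h) xh.
- move=> y; rewrite in_itv/= => /andP[y1 y2]; apply: df.
  by rewrite (lt_trans ax y1) (lt_trans y2 hb).
- apply: derivable_within_continuous => y; rewrite in_itv/= => /andP[y1 y2].
  have ayb : a < y < b by rewrite (lt_le_trans ax y1) (le_lt_trans y2 hb).
  by case: (df y ayb).
rewrite in_itv/= => /andP[c1 c2] E.
have [] := he (c - x); first by rewrite subr_gt0 c1 ltrBlDl (lt_trans c2)// ltrD2l.
rewrite f1x addrC subrK => f1c _.
have : 0 < f (x + h) - f x by rewrite E mulr_gt0// subr_gt0.
by rewrite subr_gt0 ltNge fmax// hb (lt_trans ax xh).
Qed.

(** A maximum above [kap] would have [zxx <= 0] and, seen from earlier times, [zt >= 0], against the
    strict inequality assumed. That inequality is demanded only where [z] exceeds [kap]. *)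
Lemma maximum_principle (z zt zx zxx : R -> R -> R) (t0 t1 r kap : R) :
  {within box t0 t1 (- r) r, continuous (fun p => z p.1 p.2)} ->
  (forall t x : R, t0 < t <= t1 -> is_derive t 1 (z^~ x) (zt t x)) ->
  (forall t x : R, t0 < t <= t1 -> is_derive x 1 (z t) (zx t x)) ->
  (forall t x : R, t0 < t <= t1 -> is_derive x 1 (zx t) (zxx t x)) ->
  (forall t x, t0 < t <= t1 -> - r < x < r -> kap < z t x -> zxx t x <= 0 ->
    zt t x < 0) ->
  (forall x, - r <= x <= r -> z t0 x <= kap) ->
  (forall t, t0 <= t <= t1 -> z t r <= kap /\ z t (- r) <= kap) ->
  forall t x, t0 <= t <= t1 -> - r <= x <= r -> z t x <= kap.
Proof.
move=> cz dzt dzx dzxx key init side t x tt xx.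
have bp : box t0 t1 (- r) r (t, x) by split; rewrite /= in_itv.
have [[t' x'] /set_mem[/=]] := compact_EVT_max (ex_intro _ _ bp) (@compact_box R t0 t1 (- r) r) cz.
rewrite !in_itv/= => tt' xx' zmax.
have {}zmax s y : t0 <= s <= t1 -> - r <= y <= r -> z s y <= z t' x'.
  move=> ss yy; apply: (zmax (s, y)); apply/mem_set.
  by split; rewrite /= in_itv.
apply: le_trans (zmax _ _ tt xx) _; rewrite leNgt; apply/negP => kz.
have /andP[t'0 t'1] := tt'; have /andP[x'0 x'1] := xx'.
(* A value above [kap] keeps the maximum point off the initial and lateral sides; the final time
   stays possible. *)
have t't0 : t0 < t'.
  rewrite lt_neqAle t'0 andbT; apply: contraTneq kz => <-.
  by rewrite -leNgt init.
have x'r : - r < x' < r.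
  rewrite !lt_neqAle x'0 x'1 !andbT; apply/andP; split.
    apply: contraTneq kz => <-; rewrite -leNgt.
    by have [] := side t' tt'.
  apply: contraTneq kz => ->; rewrite -leNgt.
  by have [] := side t' tt'.
have ht : t0 < t' <= t1 by rewrite t't0.
have zxx0 : zxx t' x' <= 0.
  apply: (derive2_max x'r _ (dzxx t' x' ht)).
    by move=> y _; exact: dzx.
  by move=> y /andP[y0 y1]; apply: zmax; rewrite // !ltW.
have := key t' x' ht x'r kz zxx0; apply/negP; rewrite -leNgt.
apply: (derive_left_max t't0 (dzt t' x' ht)) => s /andP[s0 s1].
by apply: zmax; rewrite // s0 (le_trans s1).
Qed.

(** Bounded partial derivatives give joint continuity: move in [t] at fixed [x], then in [x] at the
    new time. *)
Lemma continuous_bounded_partials (z zt zx : R -> R -> R) (t0 t1 r M : R) :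
  (forall t x : R, t0 <= t <= t1 -> is_derive t 1 (z^~ x) (zt t x)) ->
  (forall t x : R, t0 <= t <= t1 -> is_derive x 1 (z t) (zx t x)) ->
  (forall t x, t0 <= t <= t1 -> - r <= x <= r -> `|zt t x| <= M) ->
  (forall t x, t0 <= t <= t1 -> - r <= x <= r -> `|zx t x| <= M) ->
  {within box t0 t1 (- r) r, continuous (fun p => z p.1 p.2)}.
Proof.
move=> dt dx tM xM; apply/subspace_continuousP => p0 [/=].
rewrite !in_itv/= => p01 p02.
have M0 : 0 <= M by exact: le_trans (tM _ _ p01 p02).
apply/cvgrPdist_lt => eps eps0.
(* Using [M + 1] avoids a zero denominator and makes [2 M del] strictly less than [eps]. *)
pose del := eps / (2 * (M + 1)).
have M1 : 0 < 2 * (M + 1) by rewrite mulr_gt0// ltr_wpDl.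
have del0 : 0 < del by rewrite divr_gt0.
rewrite near_withinE; apply/nbhs_ballP; exists del => // q [q1 q2] [/=].
rewrite !in_itv/= => bq1 bq2.
have btw (lo hi y1 y2 c : R) : lo <= y1 <= hi -> lo <= y2 <= hi ->
    Num.min y1 y2 <= c <= Num.max y1 y2 -> lo <= c <= hi.
  move=> /andP[a1 a2] /andP[a3 a4] /andP[c1 c2]; apply/andP; split.
    by apply: le_trans c1; rewrite le_min a1.
  by apply: le_trans c2 _; rewrite ge_max a2.
have [c hc Ec] := @mvt_itv _ (z^~ p0.2) (zt^~ p0.2) p0.1 q.1
  (fun s hs => dt s p0.2 (btw _ _ _ _ _ p01 bq1 hs)).
have [c' hc' Ec'] := @mvt_itv _ (z q.1) (zx q.1) p0.2 q.2
  (fun s _ => dx q.1 s bq1).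
have A1 : `|z q.1 p0.2 - z p0.1 p0.2| <= M * del.
  rewrite Ec normrM ler_pM//; first by apply: tM => //; exact: btw hc.
  by rewrite distrC ltW.
have A2 : `|z q.1 q.2 - z q.1 p0.2| <= M * del.
  rewrite Ec' normrM ler_pM//; first by apply: xM => //; exact: btw hc'.
  by rewrite distrC ltW.
rewrite distrC (le_lt_trans (ler_distD (z q.1 p0.2) _ _))//.
rewrite (le_lt_trans (lerD A2 A1))//.
have -> : M * del + M * del = eps * (M / (M + 1)).
  by rewrite /del; field; rewrite gt_eqF// ltr_wpDl.
by rewrite gtr_pMr// ltr_pdivrMr ?mul1r ?ltrDl// ltr_wpDl.
Qed.

End MaximumPrinciple.

(** * Continuity and oscillation of mollified functions *)

Section MollifiedFunctions.
Context {R : realType}.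
Implicit Types (T t x : R) (w : R * R -> R).

Lemma loc_integrableN (Omega : set (R * R)) w : loc_integrable Omega w ->
  loc_integrable Omega (fun p => - w p).
Proof.
move=> [mw iw]; split.
  exact: measurableT_comp.
by move=> K cK KO; have := iw K cK KO; move=> /integrableN.
Qed.

Lemma mollN T w (k l : R -> R) t x :
  leb2.-integrable (open_slab T) (EFin \o (fun p => w p *
    tens (fun s => k (t - s)) (fun y => l (x - y)) p)) ->
  moll T (fun p => - w p) k l t x = - moll T w k l t x.
Proof.
move=> iw; rewrite -mulN1r /moll -RintegralZl//; last exact: measurable_open_slab.
by apply: eq_Rintegral => p _; rewrite mulN1r mulNr.
Qed.

(** One box [K] contains the kernel supports for all [(t, x)] of the rectangle, so a single integral
    of [|w|] bounds them all. No sign or mass is asked of [k] and [l], so derivatives of kernels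
    qualify. *)
Lemma moll_bounded T w (k l : R -> R) (d e t0 t1 r : R) :
  loc_integrable (open_slab T) w -> continuous k -> continuous l ->
  supp_in (- d) d k -> supp_in (- e) e l -> d < t0 -> t1 < T - d ->
  exists M, forall t x, t0 <= t <= t1 -> - r <= x <= r ->
    `|moll T w k l t x| <= M.
Proof.
move=> [mw iw] ck cl sk sl dt0 t1T.
have [Mk Mk0 kM] := supp_in_bounded ck sk.
have [Ml Ml0 lM] := supp_in_bounded cl sl.
pose K := box (t0 - d) (t1 + d) (- r - e) (r + e).
have KT : K `<=` open_slab T by apply: box_open_slab; lra.
have mK : measurable (K : set (measurableTypeR R * measurableTypeR R)).
  exact: measurable_box.
have iK : leb2.-integrable K (EFin \o w) by apply: iw => //; exact: compact_box.
have iG : leb2.-integrable (open_slab T)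
    (EFin \o (fun p => `|w p| * (Mk * Ml * \1_K p))).
  apply: (@integrable_mul_supp _ _ _ leb2 (open_slab T) K (fun p => `|w p|)
    (fun p => Mk * Ml * \1_K p) (Mk * Ml)) => //.
  - exact: measurable_open_slab.
  - exact: integrable_norm iK.
  - by apply: measurableT_comp => //; exact: measurable_normr.
  - by apply: measurable_funM => //; exact: measurable_indic.
  - move=> p _; rewrite indicE normrM (ger0_norm (mulr_ge0 Mk0 Ml0)).
    by rewrite ler_piMr ?mulr_ge0//; case: (p \in K); rewrite ?normr1 ?normr0.
  - by move=> p _ nK; rewrite indicE memNset// mulr0.
exists (\int[leb2]_(p in open_slab T) (`|w p| * (Mk * Ml * \1_K p))).
move=> t x /andP[t0t tt1] /andP[rx xr].
have st : supp_in (t - d) (t + d) (fun s => k (t - s)).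
  by rewrite -{2}[d]opprK; exact: supp_in_subl sk.
have sx : supp_in (x - e) (x + e) (fun y => l (x - y)).
  by rewrite -{2}[e]opprK; exact: supp_in_subl sl.
have td : 0 < t - d by lra.
have tT : t + d < T by lra.
have im := integrable_mul_tens (conj mw iw) td tT
  (continuous_subl (c := t) ck) (continuous_subl (c := x) cl) st sx.
apply: le_trans (le_normr_Rintegral _ im) _; first exact: measurable_open_slab.
apply: le_Rintegral => //.
- exact: measurable_open_slab.
- exact: integrable_norm im.
move=> p _; rewrite normrM ler_wpM2l//.
have [Kp|Kp] := pselect (K p).
  by rewrite indicE mem_set// mulr1 normrM ler_pM.
rewrite indicE memNset// mulr0 (tens_supp (a := t0 - d) (b := t1 + d)
  (c := - r - e) (d := r + e)) ?normr0//.
- by apply: supp_inW st _ _; lra.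
- by apply: supp_inW sx _ _; lra.
Qed.

Lemma continuous_moll T w (k l : R -> R) (d e t0 t1 r : R) :
  loc_integrable (open_slab T) w -> kernel d k -> kernel e l ->
  d < t0 -> t1 < T - d ->
  {within box t0 t1 (- r) r, continuous (fun p => moll T w k l p.1 p.2)}.
Proof.
move=> lw kk kl dt0 t1T.
have [sk ksupp _ _] := kk; have [sl lsupp _ _] := kl.
have ck : continuous k by exact: (sk 0%N).
have cl : continuous l by exact: (sl 0%N).
have [M hM] := moll_bounded r lw (smoothn_continuous (smoothn_derive1 (sk 1%N)))
  cl (supp_in_derive1 ksupp) lsupp dt0 t1T.
have [N hN] := moll_bounded r lw ck
  (smoothn_continuous (smoothn_derive1 (sl 1%N)))
  ksupp (supp_in_derive1 lsupp) dt0 t1T.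
apply: (@continuous_bounded_partials _ _ (moll T w (derive1 k) l)
  (moll T w k (derive1 l)) _ _ _ (Num.max M N)).
- move=> t x /andP[h1 h2].
  apply: (is_derive_conv_t lw (sk 1%N) (continuous_subl (c := x) cl) ksupp
    (lxsupp kl (x := x))); lra.
- move=> t x /andP[h1 h2].
  by apply: (is_derive_moll_x kk kl) => //; lra.
- by move=> t x ht hx; rewrite le_max hM.
- by move=> t x ht hx; rewrite le_max hN ?orbT.
Qed.

(** An average lies within the oscillation of every averaged value. This makes the mollified
    function itself an admissible frozen coefficient in [le_moll_mul]. *)
Lemma moll_osc T w (k l : R -> R) (d e t x eta : R) :
  loc_integrable (open_slab T) w -> kernel d k -> kernel e l ->
  d < t -> t < T - d ->
  (forall p q, box (t - d) (t + d) (x - e) (x + e) p ->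
    box (t - d) (t + d) (x - e) (x + e) q -> `|w p - w q| <= eta) ->
  forall p, box (t - d) (t + d) (x - e) (x + e) p ->
    `|w p - moll T w k l t x| <= eta.
Proof.
move=> lw kk kl dt tT osc p bp; rewrite ler_norml; apply/andP; split.
  rewrite lerBrDl -lerBrDr opprK.
  apply: (le_moll kk kl dt tT lw) => q /osc/(_ bp).
  by rewrite ler_norml => /andP[_]; rewrite lerBlDl.
rewrite lerBlDl -lerBlDr.
apply: (ge_moll kk kl dt tT lw) => q /osc/(_ bp).
by rewrite ler_norml => /andP[+ _]; rewrite lerNl opprB lerBlDr lerBlDl addrC.
Qed.

(* With [w = U - V], [U Uxx - V Vxx = w Vxx + U (Uxx - Vxx)]; the first term is
   absorbed by the integrating factor, the second by the barrier. *)
Lemma barrier_ineq (E U V Ut Vt Uxx Vxx al eta G psi psi2 K : R) :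
  0 <= E <= 1 -> 0 <= U -> 0 <= al -> 0 <= eta -> 0 < G -> 0 <= U - V ->
  Ut <= 2^-1 * U * Uxx + 2^-1 * eta * al ->
  - Vt <= - (2^-1 * V * Vxx) + 2^-1 * eta * al ->
  Vxx <= al -> E * (Uxx - Vxx) - G * psi2 <= 0 ->
  2^-1 * U * psi2 < K * psi ->
  E * (Ut - Vt) - 2^-1 * al * E * (U - V) - eta * al - K * G * psi < 0.
Proof.
move=> /andP[E0 E1] U0 al0 eta0 G0 w0 hU hV hVxx hxx hK.
have h1 : E * (Ut - Vt) <= E * (2^-1 * (U * Uxx - V * Vxx) + eta * al).
  by rewrite ler_wpM2l//; lra.
have h2 : E * (U - V) * Vxx <= E * (U - V) * al by rewrite ler_wpM2l// mulr_ge0.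
have h3 : U * (E * (Uxx - Vxx)) <= U * (G * psi2).
  by rewrite ler_wpM2l//; lra.
have h4 : G * (2^-1 * U * psi2) < G * (K * psi) by rewrite ltr_pM2l.
have h5 : E * (eta * al) <= eta * al by rewrite ler_piMl// mulr_ge0.
have h6 : E * (2^-1 * (U * Uxx - V * Vxx) + eta * al) =
  2^-1 * (E * (U - V) * Vxx) + 2^-1 * (U * (E * (Uxx - Vxx))) + E * (eta * al).
  by field.
rewrite h6 in h1; lra.
Qed.

End MollifiedFunctions.

(** * Comparison *)

Section Comparison.
Context {R : realType}.
Local Notation mu1 := (@lebesgue_measure R).

Definition quartic (x : R) : R := (1 + x ^+ 2) ^+ 2.

Lemma is_derive_quartic (x : R) :
  is_derive x 1 quartic (4 * x * (1 + x ^+ 2)).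
Proof.
have dq : is_derive x 1 (fun x => 1 + x * x) (0 + (x * 1 + x * 1)).
  have di := is_derive_id x (1 : R).
  exact: is_derive_add (is_derive_cst (1 : R) x 1) (is_derive_mul di di).
by apply: is_derive_eq (is_derive_mul dq dq) _; rewrite /=; ring.
Qed.

Lemma is_derive_quartic1 (x : R) :
  is_derive x 1 (fun x => 4 * x * (1 + x ^+ 2)) (4 + 12 * x ^+ 2).
Proof.
have di := is_derive_id x (1 : R).
have dq : is_derive x 1 (fun x => 1 + x * x) (0 + (x * 1 + x * 1)).
  exact: is_derive_add (is_derive_cst (1 : R) x 1) (is_derive_mul di di).
have d4 := is_derive_mul (is_derive_cst (4 : R) x 1) di.
by apply: is_derive_eq (is_derive_mul d4 dq) _; rewrite /=; ring.
Qed.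

Lemma is_derive_expRM (K t : R) :
  is_derive t 1 (fun t => expR (K * t)) (expR (K * t) * K).
Proof.
have := is_derive_mul (is_derive_cst K t 1) (is_derive_id t (1 : R)).
rewrite mulr1 mulr0 addr0 => h.
exact: (@is_derive1_comp _ expR (fun t => K * t) t _ _ _ h).
Qed.

(** With [4 + 12 x^2 <= 12 (1 + x^2)] the left side is at most [18 C (1 + x^2)^2]; the added 1 makes
    the inequality strict. This fixes the rate [K] of the barrier. *)
Lemma barrier_room (C w x : R) : 0 <= C -> w <= 3 * C * (1 + x ^+ 2) ->
  2^-1 * w * (4 + 12 * x ^+ 2) < (18 * C + 1) * quartic x.
Proof.
rewrite /quartic; have := sqr_ge0 x; move: (x ^+ 2) => y y0 C0 wC.
have h1 : w * (4 + 12 * y) <= 3 * C * (1 + y) * (4 + 12 * y).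
  by rewrite ler_wpM2r//; lra.
have h2 : 3 * C * (1 + y) * (4 + 12 * y) <= 3 * C * (1 + y) * (12 * (1 + y)).
  by apply: ler_wpM2l; [rewrite !mulr_ge0//; lra|lra].
have h3 : 3 * C * (1 + y) * (12 * (1 + y)) = 36 * (C * (1 + y) ^+ 2) by ring.
have h4 : 0 < (1 + y) ^+ 2 by rewrite exprn_gt0//; lra.
have -> : 2^-1 * w * (4 + 12 * y) = 2^-1 * (w * (4 + 12 * y)) by rewrite mulrA.
have -> : (18 * C + 1) * (1 + y) ^+ 2 = 18 * (C * (1 + y) ^+ 2) + (1 + y) ^+ 2 by ring.
have h5 := le_trans h1 h2; rewrite h3 in h5.
by clear - h4 h5; lra.
Qed.

(** In the conclusion [2 * eta] pays for replacing [u] and [v] by their mollifications,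
    [expR (2^-1 * A)] undoes the integrating factor, and in [2 + A] the 2 is the level of the
    maximum principle and [A] bounds the primitive of [al]. *)
Lemma mollified_comparison (T : R) (u v ut uxx vt vxx : R * R -> R)
    (a : R -> R) (C d eta eps r t1 : R) :
  {within slab T, continuous u} -> {within slab T, continuous v} ->
  (forall p, slab T p -> 0 <= u p) -> (forall p, slab T p -> 0 <= v p) ->
  weak_derivative (open_slab T) 1 0 u ut ->
  weak_derivative (open_slab T) 0 2 u uxx ->
  weak_derivative (open_slab T) 1 0 v vt ->
  weak_derivative (open_slab T) 0 2 v vxx ->
  measurable_fun (setT : set (measurableTypeR R)) a -> (forall s, 0 <= a s) ->
  mu1.-integrable `]0, T[ (EFin \o a) ->
  {ae leb2, forall p : R * R, open_slab T p -> `|uxx p| <= a p.1} ->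
  {ae leb2, forall p : R * R, open_slab T p -> `|vxx p| <= a p.1} ->
  {ae leb2, forall p : R * R, open_slab T p -> ut p <= 2^-1 * u p * uxx p} ->
  {ae leb2, forall p : R * R, open_slab T p -> 2^-1 * v p * vxx p <= vt p} ->
  0 <= C -> (forall p, open_slab T p -> u p <= C * (1 + p.2 ^+ 2)) ->
  (forall x, u (0, x) <= v (0, x)) ->
  0 < d <= 1 -> 2 * d <= t1 -> t1 < T - d -> 0 <= eta -> 0 < eps ->
  3 * C <= eps * (1 + r ^+ 2) ->
  (forall p q, slab T p -> slab T q -> `|p.2| <= r + 1 ->
    `|p.1 - q.1| <= 3 * d -> `|p.2 - q.2| <= 3 * d -> `|u p - u q| <= eta) ->
  (forall p q, slab T p -> slab T q -> `|p.2| <= r + 1 ->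
    `|p.1 - q.1| <= 3 * d -> `|p.2 - q.2| <= 3 * d -> `|v p - v q| <= eta) ->
  let A := \int[mu1]_(s in `]0, T[) a s in
  forall t x, 2 * d <= t <= t1 -> - r <= x <= r ->
  u (t, x) - v (t, x) <= 2 * eta +
    expR (2^-1 * A) * (eta * (2 + A) + eps * expR ((18 * C + 1) * T) * quartic x).
Proof.
move=> cu cv u0 v0 wut wuxx wvt wvxx ma a0 ia uxxa vxxa usub vsup C0 uC init
  /andP[d0 d1] dt1 t1T eta0 eps0 rC uosc vosc A.
have lu : loc_integrable (open_slab T) u by case: wut.
have lv : loc_integrable (open_slab T) v by case: wvt.
have lut : loc_integrable (open_slab T) ut by case: wut.
have lvt : loc_integrable (open_slab T) vt by case: wvt.
have luxx : loc_integrable (open_slab T) uxx by case: wuxx.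
have lvxx : loc_integrable (open_slab T) vxx by case: wvxx.
have [th sth] := smooth_step_ex d0.
have kk := step_kernel d0 sth.
set k := derive1 th in kk.
have [Mth Mth0 kM] := supp_in_bounded (step_kernel_smooth sth 0)
  (step_kernel_supp sth).
pose al := tconv T a k.
(* With the step in place of its derivative this is a primitive of [al], between 0 and [A] for every
   [d]. *)
pose Ad := tconv T a th.
pose U t x := moll T u k k t x.
pose V t x := moll T v k k t x.
have k0 s : 0 <= k s by exact: (step_kernel_ge0 sth).
have al0 t : 0 <= al t by apply: Rintegral_ge0 => s _; rewrite mulr_ge0.
have Ad01 t : 0 <= Ad t <= A.
  apply: le_tconv_total => //; first exact: smoothn_continuous (step_smooth sth 0).
  exact: (step_itv sth).
have dAd (t : R) : is_derive t 1 Ad (al t).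
  apply: (@is_derive_tconv _ T a th t (Num.max 1 Mth)) => //.
  - exact: (step_smooth sth 1).
  - move=> s; have /andP[h1 h2] := step_itv sth s.
    by rewrite le_max ger0_norm// h2.
  - by move=> s; rewrite le_max kM orbT.
pose E t := expR (- (2^-1) * Ad t).
have dE (t : R) : is_derive t 1 E (E t * (- (2^-1) * al t)).
  have := is_derive_mul (is_derive_cst (- (2^-1) : R) t 1) (dAd t).
  rewrite mulr0 addr0 => h.
  exact: (@is_derive1_comp _ expR (fun t => - (2^-1) * Ad t) t _ _ _ h).
have E01 t : 0 < E t <= 1.
  rewrite expR_gt0/= -expR0 ler_expR mulNr oppr_le0 mulr_ge0//.
  by have /andP[] := Ad01 t.
pose K := 18 * C + 1.
pose G t := eps * expR (K * t).
have G0 t : 0 < G t by rewrite mulr_gt0// expR_gt0.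
pose z t x := E t * (U t x - V t x) - eta * Ad t - G t * quartic x.
have td t : 2 * d <= t <= t1 -> d < t /\ t < T - d.
  by move=> /andP[h1 h2]; clear - h1 h2 t1T d0; split; lra.
have tb t x p : 2 * d <= t <= t1 -> - r <= x <= r ->
    box (t - d) (t + d) (x - d) (x + d) p ->
    [/\ slab T p, open_slab T p, `|p.2| <= r + 1, `|p.1 - t| <= d & `|p.2 - x| <= d].
  move=> /andP[h1 h2] /andP[h3 h4] [/=]; rewrite !in_itv/=.
  move=> /andP[h5 h6] /andP[h7 h8].
  clear - h1 h2 h3 h4 h5 h6 h7 h8 d0 d1 t1T.
  split.
  - by split => //=; rewrite in_itv/=; apply/andP; split; lra.
  - by split => //=; rewrite in_itv/=; apply/andP; split; lra.
  - by rewrite ler_norml; apply/andP; split; lra.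
  - by rewrite ler_norml; apply/andP; split; lra.
  - by rewrite ler_norml; apply/andP; split; lra.
(* Two points of a box differ by at most [2 d] in each coordinate; the allowance [3 d] is dictated
   by [init'], where the box around time [2 d] reaches [3 d] away from time 0. *)
have osc w : loc_integrable (open_slab T) w ->
  (forall p q, slab T p -> slab T q -> `|p.2| <= r + 1 ->
    `|p.1 - q.1| <= 3 * d -> `|p.2 - q.2| <= 3 * d -> `|w p - w q| <= eta) ->
  forall t x, 2 * d <= t <= t1 -> - r <= x <= r ->
  forall p, box (t - d) (t + d) (x - d) (x + d) p ->
    `|w p - moll T w k k t x| <= eta.
  move=> lw wosc t x ht hx; have [dt tT] := td t ht.
  apply: (moll_osc lw kk kk dt tT) => p q /(tb _ _ _ ht hx)[sp _ pr p1 p2].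
  move=> /(tb _ _ _ ht hx)[sq _ _ q1 q2]; apply: wosc => //.
    rewrite (le_trans (ler_distD t _ _))// (distrC t).
    by clear - p1 q1 d0; lra.
  rewrite (le_trans (ler_distD x _ _))// (distrC x).
  by clear - p2 q2 d0; lra.
have U0 t x : 2 * d <= t <= t1 -> - r <= x <= r -> 0 <= U t x.
  move=> ht hx; have [dt tT] := td t ht.
  by apply: (ge_moll kk kk dt tT lu) => p /(tb _ _ _ ht hx)[sp _ _ _ _]; exact: u0.
have V0 t x : 2 * d <= t <= t1 -> - r <= x <= r -> 0 <= V t x.
  move=> ht hx; have [dt tT] := td t ht.
  by apply: (ge_moll kk kk dt tT lv) => p /(tb _ _ _ ht hx)[sp _ _ _ _]; exact: v0.
have UC t x : 2 * d <= t <= t1 -> - r <= x <= r -> U t x <= 3 * C * (1 + x ^+ 2).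
  move=> ht hx; have [dt tT] := td t ht.
  apply: (le_moll kk kk dt tT lu) => p /(tb _ _ _ ht hx)[_ op _ _ p2].
  rewrite (le_trans (uC _ op))// mulrAC mulrC ler_wpM2r//.
  by apply: sqr_near1; exact: le_trans d1.
pose Ut t x := moll T ut k k t x; pose Vt t x := moll T vt k k t x.
pose Ux t x := moll T u k (derive1 k) t x; pose Vx t x := moll T v k (derive1 k) t x.
pose Uxx t x := moll T uxx k k t x; pose Vxx t x := moll T vxx k k t x.
have Utle t x : 2 * d <= t <= t1 -> - r <= x <= r ->
    Ut t x <= 2^-1 * U t x * Uxx t x + 2^-1 * eta * al t.
  move=> ht hx; have [dt tT] := td t ht.
  by apply: (le_moll_mul kk kk dt tT ma a0 ia eta0 lut luxx (osc _ lu uosc _ _ ht hx)).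
have Vtge t x : 2 * d <= t <= t1 -> - r <= x <= r ->
    - Vt t x <= - (2^-1 * V t x * Vxx t x) + 2^-1 * eta * al t.
  move=> ht hx; have [dt tT] := td t ht.
  have iV w : loc_integrable (open_slab T) w ->
      moll T (fun p => - w p) k k t x = - moll T w k k t x.
    by move=> lw; apply: mollN; exact: (integrable_moll kk kk dt tT).
  rewrite -iV// -mulrN -iV//.
  apply: (le_moll_mul kk kk dt tT ma a0 ia eta0 (loc_integrableN lvt)
    (loc_integrableN lvxx) (osc _ lv vosc _ _ ht hx)).
    apply: (@filterS _ _ (ae_filter_ringOfSetsType leb2)) vxxa => p h /h.
    by rewrite normrN.
  apply: (@filterS _ _ (ae_filter_ringOfSetsType leb2)) vsup => p h /h.
  by rewrite mulrN lerN2.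
have Vxxle t x : 2 * d <= t <= t1 -> Vxx t x <= al t.
  move=> ht; have [dt tT] := td t ht.
  rewrite -[al t]mul1r; apply: le_trans (ler_norm _) _.
  apply: (normr_moll kk kk dt tT ma a0 ia lvxx).
  apply: (@filterS _ _ (ae_filter_ringOfSetsType leb2)) vxxa => p h pT.
  by rewrite mul1r ler_wpM2r ?(tens_ge0 kk kk)// h.
have dzt (t x : R) : 2 * d < t <= t1 -> is_derive t 1 (z^~ x)
    (E t * (Ut t x - Vt t x) - 2^-1 * al t * E t * (U t x - V t x) -
     eta * al t - K * G t * quartic x).
  move=> /andP[ht1 ht2]; have [dt tT] := td t (introT andP (conj (ltW ht1) ht2)).
  have dU := is_derive_moll_t kk kk dt tT x wut.
  have dV := is_derive_moll_t kk kk dt tT x wvt.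
  have d1' := is_derive_mul (dE t) (is_derive_sub dU dV).
  have d2' := is_derive_mul (is_derive_cst eta t 1) (dAd t).
  have d3' := is_derive_mul (is_derive_mul (is_derive_cst eps t 1)
    (is_derive_expRM K t)) (is_derive_cst (quartic x) t 1).
  apply: is_derive_eq (is_derive_sub (is_derive_sub d1' d2') d3') _.
  rewrite /cst /G /U /V /Ut /Vt.
  move: (moll T u k k t x) (moll T v k k t x) (moll T ut k k t x)
    (moll T vt k k t x) (E t) (al t) (Ad t) (expR _) (quartic x).
  by move=> *; ring.
have dzx (t x : R) : 2 * d < t <= t1 -> is_derive x 1 (z t)
    (E t * (Ux t x - Vx t x) - G t * (4 * x * (1 + x ^+ 2))).
  move=> /andP[ht1 ht2]; have [dt tT] := td t (introT andP (conj (ltW ht1) ht2)).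
  have dU := is_derive_moll_x kk kk dt tT x lu.
  have dV := is_derive_moll_x kk kk dt tT x lv.
  have d1' := is_derive_mul (is_derive_cst (E t) x 1) (is_derive_sub dU dV).
  have d3' := is_derive_mul (is_derive_cst (G t) x 1) (is_derive_quartic x).
  apply: is_derive_eq
    (is_derive_sub (is_derive_sub d1' (is_derive_cst (eta * Ad t) x 1)) d3') _.
  rewrite /cst /Ux /Vx.
  move: (moll T u k k t x) (moll T v k k t x) (moll T u k _ t x)
    (moll T v k _ t x) (E t) (G t) (Ad t) (quartic x).
  by move=> *; ring.
have dzxx (t x : R) : 2 * d < t <= t1 ->
    is_derive x 1 (fun x => E t * (Ux t x - Vx t x) - G t * (4 * x * (1 + x ^+ 2)))
    (E t * (Uxx t x - Vxx t x) - G t * (4 + 12 * x ^+ 2)).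
  move=> /andP[ht1 ht2]; have [dt tT] := td t (introT andP (conj (ltW ht1) ht2)).
  have dU := is_derive_moll_xx kk kk dt tT x wuxx.
  have dV := is_derive_moll_xx kk kk dt tT x wvxx.
  have d1' := is_derive_mul (is_derive_cst (E t) x 1) (is_derive_sub dU dV).
  have d3' := is_derive_mul (is_derive_cst (G t) x 1) (is_derive_quartic1 x).
  apply: is_derive_eq (is_derive_sub d1' d3') _.
  rewrite /cst /Uxx /Vxx.
  move: (moll T u k _ t x) (moll T v k _ t x) (moll T uxx k k t x)
    (moll T vxx k k t x) (E t) (G t).
  by move=> *; ring.
have quartic1 x : 1 <= quartic x.
  by rewrite -(expr1n _ 2) lerXn2r ?nnegrE ?addr_ge0 ?sqr_ge0// lerDl sqr_ge0.
have t_ge0 t : 2 * d <= t <= t1 -> 0 <= t.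
  by move=> /andP[+ _]; apply: le_trans; rewrite mulr_ge0// ltW.
have K0 : 0 <= K by rewrite addr_ge0// mulr_ge0.
have EwU t x : 2 * d <= t <= t1 -> - r <= x <= r -> E t * (U t x - V t x) <= U t x.
  move=> ht hx; have /andP[E0 E1] := E01 t.
  apply: (@le_trans _ _ (E t * U t x)); last by rewrite ler_piMl// U0.
  by rewrite ler_wpM2l ?(ltW E0)// gerBl V0.
have zle t x : z t x <= E t * (U t x - V t x) - G t * quartic x.
  by rewrite lerD2r gerBl mulr_ge0//; case/andP: (Ad01 t).
have cz : {within box (2 * d) t1 (- r) r, continuous (fun p => z p.1 p.2)}.
  have cts (f f' : R -> R) : (forall t : R, is_derive t 1 f (f' t)) -> continuous f.
    by move=> df; apply: derivable_continuous => t; case: (df t).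
  have d2 : d < 2 * d by rewrite mulr_natl mulr2n ltrDl.
  have /subspace_continuousP cU := continuous_moll (r := r) lu kk kk d2 t1T.
  have /subspace_continuousP cV := continuous_moll (r := r) lv kk kk d2 t1T.
  apply/subspace_continuousP => p bp.
  have c1 (f : R -> R) : continuous f ->
      (fun q : R * R => f q.1) @ within (box (2 * d) t1 (- r) r) (nbhs p) --> f p.1.
    move=> cf; apply: cvg_within_filter.
    by apply: (@continuous_comp _ _ _ fst f); [exact: cvg_fst|exact: cf].
  have c2 (f : R -> R) : continuous f ->
      (fun q : R * R => f q.2) @ within (box (2 * d) t1 (- r) r) (nbhs p) --> f p.2.
    move=> cf; apply: cvg_within_filter.
    by apply: (@continuous_comp _ _ _ snd f); [exact: cvg_snd|exact: cf].
  apply: cvgB; first apply: cvgB.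
  - apply: cvgM; first exact: c1 (cts _ _ dE).
    by apply: cvgB; [exact: cU|exact: cV].
  - by apply: cvgM; [exact: cvg_cst|exact: c1 (cts _ _ dAd)].
  - apply: cvgM; last exact: c2 (cts _ _ is_derive_quartic).
    apply: cvgM; first exact: cvg_cst.
    exact: c1 (cts _ _ (is_derive_expRM K)).
have key t x : 2 * d < t <= t1 -> - r < x < r -> 2 * eta < z t x ->
    E t * (Uxx t x - Vxx t x) - G t * (4 + 12 * x ^+ 2) <= 0 ->
    E t * (Ut t x - Vt t x) - 2^-1 * al t * E t * (U t x - V t x) -
      eta * al t - K * G t * quartic x < 0.
  move=> /andP[ht1 ht2] /andP[hx1 hx2] hz hxx.
  have ht : 2 * d <= t <= t1 by rewrite ltW.
  have hx : - r <= x <= r by rewrite !ltW.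
  have /andP[E0 E1] := E01 t.
  apply: (barrier_ineq (psi2 := 4 + 12 * x ^+ 2)) hxx _ => //.
  - by rewrite ltW.
  - exact: U0.
  (* The sign of [U - V]: [z > 2 eta >= 0], while [z] is at most [E (U - V)] minus a positive
     barrier. *)
  - rewrite -(pmulr_rge0 _ E0).
    have : 0 <= z t x by rewrite ltW// (le_lt_trans _ hz)// mulr_ge0.
    move=> /le_trans/(_ (zle t x)); rewrite subr_ge0; apply: le_trans.
    by rewrite mulr_ge0 ?(ltW (G0 t))// (le_trans ler01).
  - exact: Utle.
  - exact: Vtge.
  - exact: Vxxle.
  exact: barrier_room (UC t x ht hx).
(* At time [2 d] each mollified function is within [eta] of the initial data, which are ordered. *)
have init' x : - r <= x <= r -> z (2 * d) x <= 2 * eta.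
  move=> hx; have ht : 2 * d <= 2 * d <= t1 by rewrite lexx.
  have [dt tT] := td _ ht.
  have s0 : slab T (0, x).
    split => //=; rewrite in_itv/= lexx/=.
    by clear - t1T dt1 d0; lra.
  have near0 p : box (2 * d - d) (2 * d + d) (x - d) (x + d) p ->
      [/\ slab T p, `|(0 : R, x).1 - p.1| <= 3 * d & `|(0 : R, x).2 - p.2| <= 3 * d].
    move=> /(tb _ _ _ ht hx)[sp _ _ p1 p2]; split => //=.
      move: p1; rewrite sub0r normrN !ler_norml => /andP[h1 h2].
      by clear - h1 h2 d0; apply/andP; split; lra.
    rewrite distrC (le_trans p2)// ler_peMl ?(ltW d0)//.
    by rewrite (_ : 1 = 1%:R)// ler_nat.
  have xr : `|(0 : R, x).2| <= r + 1.
    rewrite /= ler_norml; move: hx => /andP[h1 h2]; clear - h1 h2.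
    by apply/andP; split; lra.
  have hU : U (2 * d) x <= u (0, x) + eta.
    have le := le_moll kk kk dt tT (x := x) (c := u (0, x) + eta) lu.
    apply: le => p bp; have [sp p1 p2] := near0 p bp.
    have := uosc _ _ s0 sp xr p1 p2; rewrite ler_norml => /andP[+ _].
    by clear; lra.
  have hV : v (0, x) - eta <= V (2 * d) x.
    have ge := ge_moll kk kk dt tT (x := x) (c := v (0, x) - eta) lv.
    apply: ge => p bp; have [sp p1 p2] := near0 p bp.
    have := vosc _ _ s0 sp xr p1 p2; rewrite ler_norml => /andP[_].
    by clear; lra.
  have w2 : U (2 * d) x - V (2 * d) x <= 2 * eta.
    by have := init x; clear - hU hV; lra.
  apply: le_trans (zle _ _) _.
  rewrite lerBlDr (@le_trans _ _ (2 * eta))//; last first.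
    by rewrite lerDl mulr_ge0 ?(ltW (G0 _))// (le_trans ler01).
  have /andP[E0 E1] := E01 (2 * d).
  apply: (@le_trans _ _ (E (2 * d) * (2 * eta))).
    by rewrite ler_wpM2l// ltW.
  by rewrite ler_piMl// mulr_ge0.
(* For [|x| = r], [U <= 3 C (1 + r^2) <= eps (1 + r^2)^2], which the barrier absorbs; [V >= 0] is
   dropped. *)
have side t : 0 <= r -> 2 * d <= t <= t1 -> z t r <= 2 * eta /\ z t (- r) <= 2 * eta.
  move=> r0 ht.
  have main x : x ^+ 2 = r ^+ 2 -> - r <= x <= r -> z t x <= 2 * eta.
    move=> xr hx; apply: (@le_trans _ _ 0); last by rewrite mulr_ge0.
    apply: le_trans (zle _ _) _; rewrite subr_le0.
    apply: le_trans (EwU _ _ ht hx) _; apply: le_trans (UC _ _ ht hx) _.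
    rewrite /quartic xr expr2 mulrA ler_wpM2r ?addr_ge0 ?sqr_ge0//.
    apply: le_trans rC _; rewrite ler_wpM2r ?addr_ge0 ?sqr_ge0//.
    by rewrite ler_peMr ?(ltW eps0)// -expR0 ler_expR mulr_ge0// t_ge0.
  by split; apply: main; rewrite ?sqrrN ?lexx ?andbT//= ?lerNl ?opprK ge0_cp.
move=> t x ht hx.
have r0 : 0 <= r.
  by move: hx => /andP[h1 h2]; clear - h1 h2; lra.
have := maximum_principle cz dzt dzx dzxx key init' (fun t => side t r0) ht hx.
rewrite /z => zt2.
have [dt tT] := td t ht.
have ptx : box (t - d) (t + d) (x - d) (x + d) (t, x).
  by split; rewrite /= in_itv/=; apply/andP; split; rewrite ?gerBl ?lerDl ltW.
have := osc _ lv vosc t x ht hx _ ptx; have := osc _ lu uosc t x ht hx _ ptx.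
rewrite !ler_norml => /andP[_ hu] /andP[hv _].
suff : U t x - V t x <= expR (2^-1 * A) *
    (eta * (2 + A) + eps * expR ((18 * C + 1) * T) * quartic x).
  move: hu hv; rewrite -/(U t x) -/(V t x).
  by move: (_ * (_ + _)) => Q; clear; lra.
have /andP[E0 E1] := E01 t; have /andP[Ad0 AdA] := Ad01 t.
rewrite -(ler_pM2l E0) mulrA.
(* Since [Ad <= A], the integrating factor is at least [exp(- A / 2)]. *)
have EA : 1 <= E t * expR (2^-1 * A).
  by rewrite -expRD -expR0 ler_expR mulNr addrC subr_ge0 ler_wpM2l// invr_ge0.
have Q0 : 0 <= eta * (2 + A) + eps * expR ((18 * C + 1) * T) * quartic x.
  apply: addr_ge0.
    by rewrite mulr_ge0// addr_ge0// (le_trans Ad0 AdA).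
  apply: mulr_ge0; last exact: le_trans ler01 (quartic1 x).
  by rewrite mulr_ge0 ?expR_ge0// ltW.
apply: (@le_trans _ _ (eta * (2 + A) + eps * expR ((18 * C + 1) * T) * quartic x));
  last by rewrite ler_peMl.
have GT : G t * quartic x <= eps * expR ((18 * C + 1) * T) * quartic x.
  rewrite ler_wpM2r ?(le_trans ler01)// ler_wpM2l ?(ltW eps0)// ler_expR.
  by rewrite ler_wpM2l// ltW// (lt_le_trans tT)// gerBl ltW.
have eA : eta * Ad t <= eta * A by rewrite ler_wpM2l.
move: zt2 GT eA; move: (E t * _) (G t * _) (eps * _ * _) => w1 w2 w3.
by clear; lra.
Qed.

End Comparison.

(** * Choice of parameters and passage to the limit *)

Section Conclusion.
Context {R : realType}.
Local Notation mu1 := (@lebesgue_measure R).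

(** At a fixed point and for a given error [del], the choices go in this order: [eps] and [eta] from
    [A], [C], [T] and [x]; then [r] from [eps]; last [d], from the moduli of continuity at radius
    [r + 1]. The order is possible because [A] and [C] do not depend on [d]. *)
Lemma comparison_interior (T : R) (u v ut uxx vt vxx : R * R -> R)
    (a : R -> R) (C : R) :
  {within slab T, continuous u} -> {within slab T, continuous v} ->
  (forall p, slab T p -> 0 <= u p) -> (forall p, slab T p -> 0 <= v p) ->
  weak_derivative (open_slab T) 1 0 u ut ->
  weak_derivative (open_slab T) 0 2 u uxx ->
  weak_derivative (open_slab T) 1 0 v vt ->
  weak_derivative (open_slab T) 0 2 v vxx ->
  measurable_fun (setT : set (measurableTypeR R)) a -> (forall s, 0 <= a s) ->
  mu1.-integrable `]0, T[ (EFin \o a) ->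
  {ae leb2, forall p : R * R, open_slab T p -> `|uxx p| <= a p.1} ->
  {ae leb2, forall p : R * R, open_slab T p -> `|vxx p| <= a p.1} ->
  {ae leb2, forall p : R * R, open_slab T p -> ut p <= 2^-1 * u p * uxx p} ->
  {ae leb2, forall p : R * R, open_slab T p -> 2^-1 * v p * vxx p <= vt p} ->
  0 <= C -> (forall p, open_slab T p -> u p <= C * (1 + p.2 ^+ 2)) ->
  (forall x, u (0, x) <= v (0, x)) ->
  forall t x, 0 < t < T -> u (t, x) <= v (t, x).
Proof.
move=> cu cv u0 v0 wut wuxx wvt wvxx ma a0 ia uxxa vxxa usub vsup C0 uC init.
move=> t x /andP[t0 tT].
pose A := \int[mu1]_(s in `]0, T[) a s.
have A0 : 0 <= A by apply: Rintegral_ge0.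
pose X := expR (2^-1 * A); have X0 : 0 < X by exact: expR_gt0.
pose Y := expR ((18 * C + 1) * T) * quartic x.
have Y0 : 0 <= Y by rewrite mulr_ge0 ?expR_ge0// sqr_ge0.
apply/ler_addgt0Pr => del del0; rewrite addrC -lerBlDr.
have D1 : 0 < 2 * (X * Y + 1) by rewrite mulr_gt0// ltr_wpDl// mulr_ge0// ltW.
have D2 : 0 < 2 * (2 + X * (2 + A)).
  by rewrite mulr_gt0// addr_gt0// mulr_gt0// ltr_wpDr.
(* The barrier term then costs at most [del / 2], and the terms in [eta] add up to exactly
   [del / 2]. *)
pose eps := del / (2 * (X * Y + 1)).
pose eta := del / (2 * (2 + X * (2 + A))).
have eps0 : 0 < eps by exact: divr_gt0.
have eta0 : 0 < eta by exact: divr_gt0.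
(* Puts [x] inside the rectangle and gives [3 C / eps <= r <= 1 + r^2]. *)
pose r := `|x| + 3 * C / eps.
have Ce : 0 <= 3 * C / eps by apply: divr_ge0; [exact: mulr_ge0|exact: ltW].
have rC : 3 * C <= eps * (1 + r ^+ 2).
  rewrite [leRHS]mulrC -ler_pdivrMr//; apply: (@le_trans _ _ r); first by rewrite lerDr.
  by clearbody r; have := sqr_ge0 (r - 1); clear; nra.
have [dl dl0 hdl] := unif_continuous_slab (r + 1) cu eta0.
have [dl' dl'0 hdl'] := unif_continuous_slab (r + 1) cv eta0.
(* The quarters give [3 d < dl] and [3 d < dl']; the halves give [2 d <= t] and [t < T - d]. *)
pose d := Num.min 1 (Num.min (Num.min (dl / 4) (dl' / 4))
  (Num.min (t / 2) ((T - t) / 2))).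
have d0 : 0 < d by rewrite !lt_min !divr_gt0// ?ltr01// subr_gt0.
have [d1 d_dl d_dl' d_t d_T] :
    [/\ d <= 1, d <= dl / 4, d <= dl' / 4, d <= t / 2 & d <= (T - t) / 2].
  split; last by rewrite !ge_min lexx !orbT.
  - by rewrite ge_min lexx.
  - by rewrite !ge_min lexx !orbT.
  - by rewrite !ge_min lexx !orbT.
  - by rewrite !ge_min lexx !orbT.
have d3 : 3 * d < dl by clear - d_dl d0; lra.
have d3' : 3 * d < dl' by clear - d_dl' d0; lra.
have dt : 2 * d <= t by clear - d_t; lra.
have dT : t < T - d by clear - d_T d0 tT; lra.
have := @mollified_comparison R T u v ut uxx vt vxx a C d eta eps r t
  cu cv u0 v0 wut wuxx wvt wvxx ma a0 ia uxxa vxxa usub vsup C0 uC init.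
move=> /(_ (introT andP (conj d0 d1)) dt dT (ltW eta0) eps0 rC).
have osc (w : R * R -> R) rho : 3 * d < rho ->
    (forall p q, slab T p -> slab T q -> `|p.2| <= r + 1 ->
      `|p.1 - q.1| < rho -> `|p.2 - q.2| < rho -> `|w p - w q| < eta) ->
    forall p q, slab T p -> slab T q -> `|p.2| <= r + 1 ->
      `|p.1 - q.1| <= 3 * d -> `|p.2 - q.2| <= 3 * d -> `|w p - w q| <= eta.
  move=> dr h p q sp sq pr p1 p2; apply/ltW/h => //.
    exact: le_lt_trans dr.
  exact: le_lt_trans dr.
move=> /(_ (osc _ _ d3 hdl) (osc _ _ d3' hdl') t x).
rewrite dt lexx => /(_ isT).
have xr : - r <= x <= r.
  by rewrite -ler_norml lerDl.
move=> /(_ xr)/le_trans; apply; rewrite -/A -/X -mulrA -/Y.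
have e1 : X * (eps * Y) <= del / 2.
  rewrite [leLHS](_ : _ = del / 2 * ((X * Y) / (X * Y + 1))); last first.
    by rewrite /eps; field; rewrite gt_eqF// ltr_wpDl// mulr_ge0// ltW.
  rewrite ler_piMr ?divr_ge0 ?(ltW del0)// ler_pdivrMr ?mul1r ?lerDl//.
  by rewrite ltr_wpDl// mulr_ge0// ltW.
have e2 : 2 * eta + X * (eta * (2 + A)) = del / 2.
  by rewrite /eta; field; rewrite gt_eqF// addr_gt0// mulr_gt0// ltr_wpDr.
rewrite mulrDr addrA e2.
by clear - e1; lra.
Qed.

Lemma japanese_bracket_weight (g : R) (x y : R) :
  `|japanese_bracket x ^- 2 * g| <= y -> `|g| <= (1 + x ^+ 2) * y.
Proof.
have x0 : 0 < 1 + x ^+ 2 by rewrite ltr_pwDl// sqr_ge0.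
rewrite /japanese_bracket addrC sqr_sqrtr ?(ltW x0)//.
by rewrite normrM ger0_norm ?invr_ge0 ?(ltW x0)// mulrC ler_pdivrMr// mulrC.
Qed.

End Conclusion.

Theorem proposition2p2 (R : realType) (T : R)
    (up um dt_up dt_um dxx_up dxx_um : R * R -> R)
    (T_gt0 : 0 < T)
    (up_cont : {within slab T, continuous up})
    (um_cont : {within slab T, continuous um})
    (up_ge0 : forall p, slab T p -> 0 <= up p)
    (um_ge0 : forall p, slab T p -> 0 <= um p)
    (dt_upE : weak_derivative (open_slab T) 1 0 up dt_up)
    (dt_umE : weak_derivative (open_slab T) 1 0 um dt_um)
    (dxx_upE : weak_derivative (open_slab T) 0 2 up dxx_up)
    (dxx_umE : weak_derivative (open_slab T) 0 2 um dxx_um)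
    (dxx_up_L1Linfty : L1Linfty T dxx_up)
    (dxx_um_L1Linfty : L1Linfty T dxx_um)
    (dt_up_L1Linfty :
      L1Linfty T (fun p => japanese_bracket p.2 ^- 2 * dt_up p))
    (dt_um_L1Linfty :
      L1Linfty T (fun p => japanese_bracket p.2 ^- 2 * dt_um p))
    (up_super : {ae leb2, forall p : R * R, slab T p ->
      2^-1 * up p * dxx_up p <= dt_up p})
    (um_sub : {ae leb2, forall p : R * R, slab T p ->
      dt_um p <= 2^-1 * um p * dxx_um p})
    (init : forall x : R, um (0, x) <= up (0, x)) :
  forall t x : R, 0 <= t <= T -> um (t, x) <= up (t, x).
Proof.
have wslab (P : R * R -> Prop) : {ae leb2, forall p, slab T p -> P p} ->
    {ae leb2, forall p, open_slab T p -> P p}.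
  apply: (@filterS _ _ (ae_filter_ringOfSetsType leb2)) => p h [p1 _].
  by apply: h; split => //; exact: subset_itv_oo_cc.
have [a [ma a0 ia dxx_upa]] := L1Linfty_dominated dxx_up_L1Linfty.
have [a' [ma' a'0 ia' dxx_uma]] := L1Linfty_dominated dxx_um_L1Linfty.
have [b [mb b0 ib dt_umb]] := L1Linfty_dominated dt_um_L1Linfty.
have {}dt_umb : {ae leb2, forall p : R * R, open_slab T p ->
    `|dt_um p| <= (1 + p.2 ^+ 2) * b p.1}.
  move: dt_umb; apply: (@filterS _ _ (ae_filter_ringOfSetsType leb2)) => p h /h.
  exact: japanese_bracket_weight.
have [C C0 umC] := quadratic_growth T_gt0 um_cont dt_umE dxx_umE ma' a'0 ia'
  dxx_uma mb b0 ib dt_umb.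
have interior : forall t x, 0 < t < T -> um (t, x) <= up (t, x).
  (* The sum is a common majorant of both second derivatives. *)
  apply: (comparison_interior (a := fun s => a s + a' s) um_cont up_cont um_ge0
    up_ge0 dt_umE dxx_umE dt_upE dxx_upE _ _ _ _ _ (wslab _ um_sub)
    (wslab _ up_super) C0 umC init).
  - exact: measurable_funD.
  - by move=> s; rewrite addr_ge0.
  - have mI : measurable (`]0, T[ : set (measurableTypeR R)) by exact: measurable_itv.
    by have := integrableD mI ia ia'; apply: eq_integrable.
  - move: dxx_uma; apply: (@filterS _ _ (ae_filter_ringOfSetsType leb2)) => p h /h.
    by move/le_trans; apply; rewrite lerDr.
  - move: dxx_upa; apply: (@filterS _ _ (ae_filter_ringOfSetsType leb2)) => p h /h.
    by move/le_trans; apply; rewrite lerDl.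
move=> t x /andP[]; rewrite le_eqVlt => /predU1P[<- _|t0]; first exact: init.
rewrite le_eqVlt => /predU1P[->|tT]; last by apply: interior; rewrite t0.
(* The final time is reached by continuity: going from [T] back to some [s < T] costs [del / 2] for
   each function. *)
apply/ler_addgt0Pr => del del0.
have del2 : 0 < del / 2 by exact: divr_gt0.
have [d d0 hd] := unif_continuous_slab `|x| um_cont del2.
have [d' d'0 hd'] := unif_continuous_slab `|x| up_cont del2.
pose s := T - Num.min (T / 2) (Num.min (d / 2) (d' / 2)).
have Ts : T - s = Num.min (T / 2) (Num.min (d / 2) (d' / 2)).
  by rewrite /s opprB addrC subrK.
have [s1 s2 s3 s4] : [/\ 0 < T - s, T - s <= T / 2, T - s <= d / 2 & T - s <= d' / 2].
  rewrite Ts; split; last by rewrite !ge_min lexx !orbT.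
  - by rewrite !lt_min !divr_gt0.
  - by rewrite ge_min lexx.
  - by rewrite !ge_min lexx !orbT.
have sT : 0 < s < T by apply/andP; split; lra.
have slabs : slab T (s, x) by split; rewrite //= in_itv/=; apply/andP; split; lra.
have slabT : slab T (T, x) by split; rewrite //= in_itv/= lexx ltW.
have dist e : 0 < e -> T - s <= e / 2 -> `|T - s| < e.
  by move=> e0 se; rewrite gtr0_norm//; lra.
have := hd _ _ slabT slabs (lexx _) (dist _ d0 s3).
have := hd' _ _ slabT slabs (lexx _) (dist _ d'0 s4).
rewrite /= subrr normr0 => /(_ d'0) + /(_ d0).
rewrite !ltr_norml => /andP[h1 _] /andP[_ h2].
by have := interior s x sT; lra.
Qed.
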